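(* Let $G$ be a compressible Borel graph of finite maximum degree. If $G$ admits a Borel proper $k$-coloring (i.e., $\chi_{\mathrm{B}}(G)\leq k$), then $G$ has a Borel-equitable $k$-coloring.
   Context: A Borel graph has a standard Borel vertex set and Borel edge set. For Borel $A,B$, $A\approx_G B$ means there is a Borel bijection $\phi\colon A\to B$ with $\phi(x)$ in the same connected component as $x$. $[U]_G$ is the union of connected components meeting $U$. A Borel set $U$ is $G$-compressible if there is Borel $A\subseteq U$ with $[A]_G=[U]_G$ and $U\approx_G U\setminus A$; $G$ is compressible if $V(G)$ is $G$-compressible. A Borel-equitable $k$-coloring is a Borel proper $k$-coloring $f$ with $f^{-1}(\alpha)\approx_G f^{-1}(\beta)$ for all colors $\alpha,\beta$. *)

(* Defs.v *)
From Stdlib Require Import Reals List Relations.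
Open Scope R_scope.

Inductive sigma_gen {X : Type} (F : (X -> Prop) -> Prop) : (X -> Prop) -> Prop :=
| sg_base A : F A -> sigma_gen F A
| sg_empty : sigma_gen F (fun _ => False)
| sg_compl A : sigma_gen F A -> sigma_gen F (fun x => ~ A x)
| sg_union (A : nat -> X -> Prop) :
    (forall n, sigma_gen F (A n)) -> sigma_gen F (fun x => exists n, A n x)
| sg_ext A A' : sigma_gen F A -> (forall x, A x <-> A' x) -> sigma_gen F A'.

Definition is_metric {X : Type} (d : X -> X -> R) : Prop :=
  (forall x y, 0 <= d x y) /\
  (forall x y, d x y = 0 <-> x = y) /\
  (forall x y, d x y = d y x) /\
  (forall x y z, d x z <= d x y + d y z).

Definition cauchy {X : Type} (d : X -> X -> R) (u : nat -> X) : Prop :=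
  forall eps, 0 < eps -> exists N, forall m n, (N <= m)%nat -> (N <= n)%nat -> d (u m) (u n) < eps.

Definition converges_to {X : Type} (d : X -> X -> R) (u : nat -> X) (l : X) : Prop :=
  forall eps, 0 < eps -> exists N, forall n, (N <= n)%nat -> d (u n) l < eps.

Definition complete_metric {X : Type} (d : X -> X -> R) : Prop :=
  forall u, cauchy d u -> exists l, converges_to d u l.

(* Separable: a countable dense set (enumerated with possible gaps, to allow X empty). *)
Definition separable_metric {X : Type} (d : X -> X -> R) : Prop :=
  exists s : nat -> option X, forall x eps, 0 < eps ->
    exists n y, s n = Some y /\ d x y < eps.

Definition polish_metric {X : Type} (d : X -> X -> R) : Prop :=
  is_metric d /\ complete_metric d /\ separable_metric d.

Definition metric_open {X : Type} (d : X -> X -> R) (U : X -> Prop) : Prop :=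
  forall x, U x -> exists eps, 0 < eps /\ forall y, d x y < eps -> U y.

Definition standard_borel {X : Type} (B : (X -> Prop) -> Prop) : Prop :=
  exists d : X -> X -> R, polish_metric d /\
    forall A, B A <-> sigma_gen (metric_open d) A.

Definition prod_sigma {X : Type} (B : (X -> Prop) -> Prop) : ((X * X) -> Prop) -> Prop :=
  sigma_gen (fun S => exists A1 A2, B A1 /\ B A2 /\
                       forall p, S p <-> (A1 (fst p) /\ A2 (snd p))).

Definition borel_graph {V : Type} (B : (V -> Prop) -> Prop) (E : V -> V -> Prop) : Prop :=
  standard_borel B /\
  (forall x y, E x y -> E y x) /\
  (forall x, ~ E x x) /\
  prod_sigma B (fun p => E (fst p) (snd p)).

Definition finite_max_degree {V : Type} (E : V -> V -> Prop) : Prop :=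
  exists D : nat, forall x (l : list V), NoDup l -> (forall y, In y l -> E x y) ->
    (length l <= D)%nat.

Definition conn {V : Type} (E : V -> V -> Prop) : V -> V -> Prop :=
  clos_refl_trans V E.

(* A ≈_G A' : a Borel bijection phi : A -> A' with phi x in the component of x.
   phi is given as a total function on V; only its restriction to A matters,
   and Borel-measurability is measurability of that restriction. *)
Definition borel_equidec {V : Type} (B : (V -> Prop) -> Prop) (E : V -> V -> Prop)
    (A A' : V -> Prop) : Prop :=
  exists phi : V -> V,
    (forall S, B S -> B (fun x => A x /\ S (phi x))) /\
    (forall x, A x -> A' (phi x)) /\
    (forall x y, A x -> A y -> phi x = phi y -> x = y) /\
    (forall y, A' y -> exists x, A x /\ phi x = y) /\
    (forall x, A x -> conn E x (phi x)).

Definition saturation {V : Type} (E : V -> V -> Prop) (U : V -> Prop) : V -> Prop :=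
  fun x => exists u, U u /\ conn E x u.

Definition compressible_set {V : Type} (B : (V -> Prop) -> Prop) (E : V -> V -> Prop)
    (U : V -> Prop) : Prop :=
  exists A : V -> Prop, B A /\ (forall x, A x -> U x) /\
    (forall x, saturation E A x <-> saturation E U x) /\
    borel_equidec B E U (fun x => U x /\ ~ A x).

Definition compressible {V : Type} (B : (V -> Prop) -> Prop) (E : V -> V -> Prop) : Prop :=
  compressible_set B E (fun _ => True).

Definition borel_proper_coloring {V : Type} (B : (V -> Prop) -> Prop) (E : V -> V -> Prop)
    (k : nat) (f : V -> nat) : Prop :=
  (forall x, (f x < k)%nat) /\
  (forall i, B (fun x => f x = i)) /\
  (forall x y, E x y -> f x <> f y).

Definition borel_equitable_coloring {V : Type} (B : (V -> Prop) -> Prop) (E : V -> V -> Prop)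
    (k : nat) (f : V -> nat) : Prop :=
  borel_proper_coloring B E k f /\
  forall a b, (a < k)%nat -> (b < k)%nat ->
    borel_equidec B E (fun x => f x = a) (fun x => f x = b).

(* Main.v *)
Require Import Defs.
From Stdlib Require Import Reals List Relations.
From Stdlib Require Import Lra Lia Arith Cantor Classical ClassicalEpsilon
  FunctionalExtensionality PropExtensionality FinFun.

(** Recoloring a sparse Borel set of vertices one color at a time makes every color class
    meet all balls of some fixed radius: a vertex of a sparse maximal set takes the new color
    unless a neighbor already has it, and the old classes stay dense because components are
    infinite. Let [phi] be an injection of [V] onto the complement of a complete section [A].
    The orbits [phi^n(a)] with [a] in [A] are disjoint, so they spread [A * nat] in [V], and
    retracting them to nearby vertices of a dense class [U] is finite-to-one; a pigeonhole on
    finitely many labels yields a Borel injection of [V] into [U] along components. By the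
    Schroeder-Bernstein argument any two dense classes are equidecomposable.

    Measurability rests on one fact of Lusin-Novikov type: the projection of a Borel set whose
    sections have bounded size is Borel. For sections with at most one element it follows from
    the separation of disjoint analytic sets; the general case is by induction on the bound. *)

Local Open Scope nat_scope.

(** * Measurability and analytic sets *)

(** Unrestricted choice: wherever a chosen function has to be Borel, this is proved separately from
    its specification. *)
Lemma choice {X Y : Type} (R : X -> Y -> Prop) :
  (forall x, exists y, R x y) -> exists f : X -> Y, forall x, R x (f x).
Proof.
  intros HR. exists (fun x => proj1_sig (constructive_indefinite_description _ (HR x))).
  intros x. apply proj2_sig.
Qed.

Class SigmaAlgebra {X : Type} (B : (X -> Prop) -> Prop) : Prop := {
  sa_empty : B (fun _ => False);
  sa_not : forall A, B A -> B (fun x => ~ A x);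
  sa_ex : forall A : nat -> X -> Prop, (forall n, B (A n)) -> B (fun x => exists n, A n x);
  sa_ext : forall A A', B A -> (forall x, A x <-> A' x) -> B A' }.

Global Instance sigma_gen_algebra {X : Type} (F : (X -> Prop) -> Prop) :
  SigmaAlgebra (sigma_gen F).
Proof.
  split.
  - apply sg_empty.
  - apply sg_compl.
  - apply sg_union.
  - apply sg_ext.
Qed.

Section SigmaAlgebraClosure.
Context {X : Type} (B : (X -> Prop) -> Prop) `{SigmaAlgebra X B}.

Lemma sa_all (A : nat -> X -> Prop) : (forall n, B (A n)) -> B (fun x => forall n, A n x).
Proof.
  intros HA. apply (sa_ext (fun x => ~ exists n, ~ A n x)).
  - apply sa_not, sa_ex. intros n. apply sa_not, HA.
  - intros x. split; [|firstorder].
    intros Hx n. apply NNPP. intros Hn. apply Hx. now exists n.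
Qed.

Lemma sa_const (P : Prop) : B (fun _ => P).
Proof.
  destruct (classic P) as [HP|HP].
  - apply (sa_ext (fun _ => ~ False)); [apply sa_not, sa_empty|tauto].
  - apply (sa_ext (fun _ => False)); [apply sa_empty|tauto].
Qed.

Lemma sa_or (A A' : X -> Prop) : B A -> B A' -> B (fun x => A x \/ A' x).
Proof.
  intros HA HA'.
  apply (sa_ext (fun x => exists n, match n with 0 => A x | _ => A' x end)).
  - apply (sa_ex (fun n x => match n with 0 => A x | _ => A' x end)). now intros [|n].
  - intros x. split.
    + intros [[|n] Hx]; tauto.
    + intros [Hx|Hx]; [now exists 0|now exists 1].
Qed.

Lemma sa_and (A A' : X -> Prop) : B A -> B A' -> B (fun x => A x /\ A' x).
Proof.
  intros HA HA'. apply (sa_ext (fun x => ~ (~ A x \/ ~ A' x))).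
  - apply sa_not, sa_or; now apply sa_not.
  - intros x. tauto.
Qed.

Lemma sa_imp (A A' : X -> Prop) : B A -> B A' -> B (fun x => A x -> A' x).
Proof.
  intros HA HA'. apply (sa_ext (fun x => ~ A x \/ A' x)).
  - apply sa_or; [now apply sa_not|easy].
  - intros x. tauto.
Qed.

End SigmaAlgebraClosure.

Ltac borel :=
  repeat (try assumption;
    lazymatch goal with
    | |- ?B ?A =>
      first
        [ apply (sa_const B)
        | apply (sa_not (B := B))
        | apply (sa_and B)
        | apply (sa_or B)
        | apply (sa_imp B)
        | apply (sa_ex (B := B)); intro
        | apply (sa_all B); intro ]
    end).

Definition meas {X Y : Type} (BX : (X -> Prop) -> Prop) (BY : (Y -> Prop) -> Prop)
    (f : X -> Y) : Prop := forall S, BY S -> BX (fun x => S (f x)).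

(** With both factors equal this is convertible to [prod_sigma], so the edge set of a Borel graph is
    a Borel relation as it stands. Distinct factors allow iterated products such as
    [(V * V) * V]. *)
Definition psigma {X Y : Type} (BX : (X -> Prop) -> Prop) (BY : (Y -> Prop) -> Prop) :
    (X * Y -> Prop) -> Prop :=
  sigma_gen (fun S => exists A1 A2, BX A1 /\ BY A2 /\
                       forall p, S p <-> (A1 (fst p) /\ A2 (snd p))).

Global Instance psigma_algebra {X Y : Type} (BX : (X -> Prop) -> Prop)
  (BY : (Y -> Prop) -> Prop) : SigmaAlgebra (psigma BX BY).
Proof. apply sigma_gen_algebra. Qed.

Lemma meas_gen {X Y : Type} (BX : (X -> Prop) -> Prop) `{SigmaAlgebra X BX}
    (F : (Y -> Prop) -> Prop) (f : X -> Y) :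
  (forall S, F S -> BX (fun x => S (f x))) -> meas BX (sigma_gen F) f.
Proof.
  intros HF S HS. induction HS as [A HA| |A HA IH|A HA IH|A A' HA IH Hext].
  - now apply HF.
  - borel.
  - now apply sa_not.
  - now apply (sa_ex (fun n x => A n (f x))).
  - apply (sa_ext _ _ IH). intros x. apply Hext.
Qed.

Lemma meas_comp {X Y Z : Type} (BX : (X -> Prop) -> Prop) (BY : (Y -> Prop) -> Prop)
    (BZ : (Z -> Prop) -> Prop) (g : Y -> Z) (f : X -> Y) :
  meas BY BZ g -> meas BX BY f -> meas BX BZ (fun x => g (f x)).
Proof. intros Hg Hf S HS. apply (Hf (fun y => S (g y))). now apply Hg. Qed.

Lemma meas_pair {X Y Z : Type} (BX : (X -> Prop) -> Prop) `{SigmaAlgebra X BX}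
    (BY : (Y -> Prop) -> Prop) (BZ : (Z -> Prop) -> Prop) (f : X -> Y) (g : X -> Z) :
  meas BX BY f -> meas BX BZ g -> meas BX (psigma BY BZ) (fun x => (f x, g x)).
Proof.
  intros Hf Hg. apply meas_gen; [exact _|].
  intros S (A1 & A2 & H1 & H2 & HS).
  apply (sa_ext (fun x => A1 (f x) /\ A2 (g x))).
  - apply sa_and; [exact _|now apply Hf|now apply Hg].
  - intros x. rewrite HS. reflexivity.
Qed.

Lemma meas_id {X : Type} (BX : (X -> Prop) -> Prop) : meas BX BX (fun x => x).
Proof. now intros S HS. Qed.

Lemma meas_fst {X Y : Type} (BX : (X -> Prop) -> Prop) (BY : (Y -> Prop) -> Prop)
    `{SigmaAlgebra Y BY} : meas (psigma BX BY) BX fst.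
Proof.
  intros S HS. apply sg_base. exists S, (fun _ => True).
  repeat split; try easy. borel.
Qed.

Lemma meas_snd {X Y : Type} (BX : (X -> Prop) -> Prop) (BY : (Y -> Prop) -> Prop)
    `{SigmaAlgebra X BX} : meas (psigma BX BY) BY snd.
Proof.
  intros S HS. apply sg_base. exists (fun _ => True), S.
  repeat split; try easy. borel.
Qed.

(** * Analytic sets as images of Baire space *)

Definition agree (m : nat) (a b : nat -> nat) : Prop := forall n, n < m -> a n = b n.

Lemma agree_le m m' a b : m <= m' -> agree m' a b -> agree m a b.
Proof. intros Hm H n Hn. apply H. lia. Qed.

(** Continuity of reindexing: finitely many terms of the original sequence determine the first [m]
    terms of the new one. *)
Lemma agree_reindex (g : nat -> nat) (m : nat) :
  exists m', forall a b, agree m' a b -> agree m (fun n => a (g n)) (fun n => b (g n)).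
Proof.
  induction m as [|m [m' IH]].
  - exists 0. intros a b _ n Hn. lia.
  - exists (m' + S (g m)). intros a b Hab n Hn.
    destruct (Nat.eq_dec n m) as [->|Hnm].
    + apply Hab. lia.
    + apply (IH a b); [|lia]. apply (agree_le _ (m' + S (g m))); [lia|easy].
Qed.

(* [rho] is an upper semicontinuous multivalued map from Baire space: near [a] its values
   are either empty or concentrate at one point of [A]. Multivaluedness avoids choosing
   values on a closed domain. *)
Definition usco {X : Type} (O : (X -> Prop) -> Prop) (A : X -> Prop)
    (rho : (nat -> nat) -> X -> Prop) : Prop :=
  forall a,
    (exists m, forall b, agree m a b -> forall y, ~ rho b y) \/
    (exists x, A x /\ forall U, O U -> U x ->
       exists m, forall b, agree m a b -> forall y, rho b y -> U y).

(** For [O] hausdorff each [rho a] has at most one point, so [rho] is a partial parametrization of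
    [A] by Baire space. *)
Definition analytic {X : Type} (O : (X -> Prop) -> Prop) (A : X -> Prop) : Prop :=
  exists rho, (forall x, A x <-> exists a, rho a x) /\ usco O A rho.

Definition hausdorff {X : Type} (O : (X -> Prop) -> Prop) : Prop :=
  forall x y, x <> y -> exists U U', O U /\ O U' /\ U x /\ U' y /\ forall z, U z -> ~ U' z.

Section Analytic.
Context {X : Type} (O : (X -> Prop) -> Prop).

Lemma analytic_ext (A A' : X -> Prop) :
  analytic O A -> (forall x, A x <-> A' x) -> analytic O A'.
Proof.
  intros (rho & HA & Hu) Hext. exists rho. split.
  - intros x. now rewrite <- Hext.
  - intros a. destruct (Hu a) as [Hd|(x & Hx & HU)]; [now left|right].
    exists x. split; [now apply Hext|easy].
Qed.

Lemma analytic_empty : analytic O (fun _ => False).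
Proof.
  exists (fun _ _ => False). split; [firstorder|]. intros a. left. now exists 0.
Qed.

(** The first term of a code selects the index [n]; the shifted sequence is a code for [A n]. *)
Lemma analytic_ex (A : nat -> X -> Prop) :
  (forall n, analytic O (A n)) -> analytic O (fun x => exists n, A n x).
Proof.
  intros HA. destruct (choice _ HA) as [rho Hrho].
  exists (fun a x => rho (a 0) (fun n => a (S n)) x). split.
  - intros x. split.
    + intros [n Hn]. apply (proj1 (Hrho n)) in Hn as [a Ha].
      now exists (fun i => match i with 0 => n | S i => a i end).
    + intros [a Ha]. exists (a 0). apply (proj1 (Hrho (a 0))). now exists (fun n => a (S n)).
  - intros a.
    assert (Hag : forall m b, agree (S m) a b ->
              a 0 = b 0 /\ agree m (fun n => a (S n)) (fun n => b (S n))).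
    { intros m b Hab. split; [apply Hab; lia|]. intros n Hn. apply Hab. lia. }
    destruct (proj2 (Hrho (a 0)) (fun n => a (S n))) as [[m Hm]|(x & Hx & HU)].
    + left. exists (S m). intros b Hab y. destruct (Hag m b Hab) as [<- Hab'].
      now apply Hm.
    + right. exists x. split; [now exists (a 0)|]. intros U HOU HUx.
      destruct (HU U HOU HUx) as [m Hm]. exists (S m). intros b Hab y.
      destruct (Hag m b Hab) as [<- Hab']. now apply Hm.
Qed.

Lemma analytic_or (A A' : X -> Prop) :
  analytic O A -> analytic O A' -> analytic O (fun x => A x \/ A' x).
Proof.
  intros HA HA'.
  apply (analytic_ext (fun x => exists n, match n with 0 => A x | _ => A' x end)).
  - apply (analytic_ex (fun n x => match n with 0 => A x | _ => A' x end)). now intros [|n].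
  - intros x. split.
    + intros [[|n] Hx]; tauto.
    + intros [Hx|Hx]; [now exists 0|now exists 1].
Qed.

(** A point of the intersection is coded by one code for each [A i], all merged into a single
    sequence by Cantor pairing. *)
Lemma analytic_all (A : nat -> X -> Prop) : hausdorff O ->
  (forall n, analytic O (A n)) -> analytic O (fun x => forall n, A n x).
Proof.
  intros HO HA. destruct (choice _ HA) as [rho Hrho].
  set (sub := fun (a : nat -> nat) i n => a (to_nat (i, n))).
  exists (fun a x => forall i, rho i (sub a i) x). split.
  - intros x. split.
    + intros Hx.
      assert (Hc : forall i, exists a, rho i a x) by (intros i; now apply (proj1 (Hrho i))).
      destruct (choice _ Hc) as [a Ha].
      exists (fun n => a (fst (of_nat n)) (snd (of_nat n))). intros i.
      replace (sub _ i) with (a i); [easy|].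
      apply functional_extensionality. intros n.
      unfold sub. now rewrite cancel_of_to.
    + intros [a Ha] i. apply (proj1 (Hrho i)). now exists (sub a i).
  - intros a.
    assert (Hag : forall i m, exists m', forall b, agree m' a b -> agree m (sub a i) (sub b i)).
    { intros i m. destruct (agree_reindex (fun n => to_nat (i, n)) m) as [m' Hm'].
      exists m'. intros b. apply Hm'. }
    destruct (proj2 (Hrho 0) (sub a 0)) as [[m Hm]|(x & Hx & HU)].
    { left. destruct (Hag 0 m) as [m' Hm']. exists m'. intros b Hab y Hy.
      now apply (Hm (sub b 0) (Hm' b Hab) y). }
    (* The limit of coordinate [0] serves if it lies in every [A i]. Otherwise some coordinate has
       no values nearby, or has another limit, and disjoint neighborhoods exclude common values. *)
    destruct (classic (forall i, A i x)) as [Hall|Hnot].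
    { right. exists x. split; [easy|]. intros U HOU HUx.
      destruct (HU U HOU HUx) as [m Hm]. destruct (Hag 0 m) as [m' Hm'].
      exists m'. intros b Hab y Hy. now apply (Hm (sub b 0) (Hm' b Hab) y). }
    left. apply not_all_ex_not in Hnot as [i Hi].
    destruct (proj2 (Hrho i) (sub a i)) as [[m Hm]|(y & Hy & HU')].
    { destruct (Hag i m) as [m' Hm']. exists m'. intros b Hab z Hz.
      now apply (Hm (sub b i) (Hm' b Hab) z). }
    assert (Hxy : x <> y) by congruence.
    destruct (HO x y Hxy) as (U & U' & HOU & HOU' & HUx & HUy & Hdis).
    destruct (HU U HOU HUx) as [m Hm]. destruct (HU' U' HOU' HUy) as [n Hn].
    destruct (Hag 0 m) as [m' Hm']. destruct (Hag i n) as [n' Hn'].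
    exists (max m' n'). intros b Hab z Hz. apply (Hdis z).
    + apply (Hm (sub b 0)); [|easy]. apply Hm'. apply (agree_le _ (max m' n')); [lia|easy].
    + apply (Hn (sub b i)); [|easy]. apply Hn'. apply (agree_le _ (max m' n')); [lia|easy].
Qed.

(** Where the limit point is outside [C], one of its neighborhoods misses [C], and the restricted
    map has no values nearby. *)
Lemma analytic_closed (A C : X -> Prop) :
  (forall x, ~ C x -> exists U, O U /\ U x /\ forall y, U y -> ~ C y) ->
  analytic O A -> analytic O (fun x => A x /\ C x).
Proof.
  intros HC (rho & HA & Hu). exists (fun a x => rho a x /\ C x). split.
  - intros x. rewrite HA. firstorder.
  - intros a. destruct (Hu a) as [[m Hm]|(x & Hx & HU)].
    + left. exists m. intros b Hab y [Hy _]. now apply (Hm b Hab y).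
    + destruct (classic (C x)) as [HCx|HCx].
      * right. exists x. split; [easy|]. intros U HOU HUx.
        destruct (HU U HOU HUx) as [m Hm]. exists m. intros b Hab y [Hy _].
        now apply (Hm b Hab).
      * left. destruct (HC x HCx) as (U & HOU & HUx & Hdis).
        destruct (HU U HOU HUx) as [m Hm]. exists m. intros b Hab y [Hy HCy].
        now apply (Hdis y (Hm b Hab y Hy)).
Qed.

Definition bianalytic (A : X -> Prop) : Prop := analytic O A /\ analytic O (fun x => ~ A x).

(** Analyticity alone does not pass to complements, so the induction carries a set together with its
    complement. *)
Lemma sigma_gen_bianalytic (F : (X -> Prop) -> Prop) : hausdorff O ->
  analytic O (fun _ => True) ->
  (forall A, F A -> bianalytic A) -> forall A, sigma_gen F A -> bianalytic A.
Proof.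
  intros HO HX HF A HA. induction HA as [A HA| |A HA IH|A HA IH|A A' HA IH Hext].
  - now apply HF.
  - split; [apply analytic_empty|]. apply (analytic_ext _ _ HX). tauto.
  - destruct IH as [H1 H2]. split; [easy|].
    apply (analytic_ext _ _ H1). intros x. split; [tauto|apply NNPP].
  - split.
    + apply analytic_ex. intros n. apply IH.
    + apply (analytic_ext (fun x => forall n, ~ A n x)).
      * apply analytic_all; [easy|]. intros n. apply IH.
      * firstorder.
  - destruct IH as [H1 H2]. split.
    + now apply (analytic_ext _ _ H1).
    + apply (analytic_ext _ _ H2). intros x. now rewrite Hext.
Qed.

End Analytic.

(** * Separation of disjoint analytic sets *)

Section Separation.
Context {X : Type} (B O : (X -> Prop) -> Prop) `{SigmaAlgebra X B}.

Definition separable_by (P Q : X -> Prop) : Prop :=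
  exists S, B S /\ (forall x, P x -> S x) /\ (forall x, Q x -> ~ S x).

(** Used in contrapositive form: if two unions cannot be separated, neither can some pair of their
    pieces. *)
Lemma separable_union (P Q : nat -> X -> Prop) :
  (forall n m, separable_by (P n) (Q m)) ->
  separable_by (fun x => exists n, P n x) (fun x => exists m, Q m x).
Proof.
  intros Hsep.
  destruct (choice (fun p S => B S /\ (forall x, P (fst p) x -> S x) /\
                               (forall x, Q (snd p) x -> ~ S x))) as [S HS].
  { intros [n m]. apply Hsep. }
  exists (fun x => exists n, forall m, S (n, m) x). split; [|split].
  - apply (sa_ex (fun n x => forall m, S (n, m) x)). intros n.
    apply (sa_all B (fun m x => S (n, m) x)). intros m. apply HS.
  - intros x [n Hn]. exists n. intros m. now apply (HS (n, m)).
  - intros x [m Hm] [n Hn]. now apply (proj2 (proj2 (HS (n, m))) x).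
Qed.

(** Each stage changes only later terms, so the stages converge, and the locality of [P n] passes it
    on to the limit. *)
Lemma dependent_limit (P : nat -> (nat -> nat) -> Prop) (a0 : nat -> nat) :
  (forall n a b, agree n a b -> P n a -> P n b) ->
  P 0 a0 ->
  (forall n a, P n a -> exists b, agree n a b /\ P (S n) b) ->
  exists a, forall n, P n a.
Proof.
  intros Hloc H0 Hstep.
  destruct (choice (fun (p : nat * (nat -> nat)) b =>
              P (fst p) (snd p) -> agree (fst p) (snd p) b /\ P (S (fst p)) b)) as [f Hf].
  { intros [n a]. destruct (classic (P n a)) as [HP|HP].
    - destruct (Hstep n a HP) as [b Hb]. now exists b.
    - exists a. easy. }
  set (s := fix s n := match n with 0 => a0 | S n => f (n, s n) end).
  assert (Hs : forall n, P n (s n)).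
  { induction n as [|n IH]; [easy|]. now apply (Hf (n, s n)). }
  assert (Hag : forall n k, agree n (s n) (s (k + n))).
  { intros n k. induction k as [|k IH]; intros i Hi; [easy|].
    rewrite (IH i Hi). apply (proj1 (Hf (k + n, s (k + n)) (Hs _))). simpl. lia. }
  (* Term [i] is final from stage [i + 1] on. *)
  exists (fun i => s (S i) i). intros n. apply (Hloc n (s n)); [|apply Hs].
  intros i Hi. replace n with ((n - S i) + S i) by lia. symmetry.
  apply Hag. lia.
Qed.

(** If [A] and [A'] were inseparable, shrinking cylinders with inseparable images would define two
    branches. The limits of these branches have disjoint open neighborhoods, which separate the
    images at a finite stage. *)
Theorem analytic_separation (A A' : X -> Prop) :
  hausdorff O -> (forall U, O U -> B U) ->
  analytic O A -> analytic O A' -> (forall x, A x -> ~ A' x) -> separable_by A A'.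
Proof.
  intros HO HOB (rho & HA & Hu) (rho' & HA' & Hu') Hdis. apply NNPP. intros Hns.
  set (im := fun (r : (nat -> nat) -> X -> Prop) n a x => exists b, agree n a b /\ r b x).
  set (upd := fun (a : nat -> nat) n k i => if Nat.eq_dec i n then k else a i).
  assert (Him : forall r n a x, im r n a x <-> exists k, im r (S n) (upd a n k) x).
  { intros r n a x. split.
    - intros (b & Hb & Hx). exists (b n), b. split; [|easy]. intros i Hi. unfold upd.
      destruct (Nat.eq_dec i n) as [->|Hin]; [easy|]. apply Hb. lia.
    - intros (k & b & Hb & Hx). exists b. split; [|easy]. intros i Hi.
      specialize (Hb i ltac:(lia)). unfold upd in Hb.
      destruct (Nat.eq_dec i n) as [->|Hin]; [lia|easy]. }
  assert (Hupd : forall a n k, agree n a (upd a n k)).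
  { intros a n k i Hi. unfold upd. destruct (Nat.eq_dec i n); [lia|easy]. }
  (* the two branches are interleaved in one sequence, [a n] being the pair of [n]-th entries *)
  set (fs := fun (a : nat -> nat) i => fst (of_nat (a i))).
  set (sn := fun (a : nat -> nat) i => snd (of_nat (a i))).
  assert (Hlim : exists a, forall n, ~ separable_by (im rho n (fs a)) (im rho' n (sn a))).
  { apply (dependent_limit (fun n a => ~ separable_by (im rho n (fs a)) (im rho' n (sn a)))
             (fun _ => 0)).
    - intros n a b Hab Hn Hs. apply Hn. destruct Hs as (S & HS & HS1 & HS2).
      exists S. split; [easy|]. unfold fs, sn in *. split.
      + intros x (c & Hc & Hx). apply HS1. exists c. split; [|easy].
        intros i Hi. rewrite <- (Hab i Hi). now apply Hc.
      + intros x (c & Hc & Hx). apply HS2. exists c. split; [|easy].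
        intros i Hi. rewrite <- (Hab i Hi). now apply Hc.
    - intros (S & HS & HS1 & HS2). apply Hns. exists S. split; [easy|]. split.
      + intros x Hx. apply HA in Hx as [b Hb]. apply HS1. exists b. split; [|easy].
        intros i Hi. lia.
      + intros x Hx. apply HA' in Hx as [b Hb]. apply HS2. exists b. split; [|easy].
        intros i Hi. lia.
    - intros n a Hn. apply NNPP. intros Hno. apply Hn.
      destruct (separable_union (fun k => im rho (S n) (upd (fs a) n k))
                  (fun k => im rho' (S n) (upd (sn a) n k))) as (T & HT & HT1 & HT2).
      + intros k l. apply NNPP. intros Hkl. apply Hno.
        exists (upd a n (to_nat (k, l))). split; [apply Hupd|].
        replace (fs _) with (upd (fs a) n k); [replace (sn _) with (upd (sn a) n l); [easy|]|];
          apply functional_extensionality; intros i;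
          unfold fs, sn, upd; destruct (Nat.eq_dec i n); now rewrite ?cancel_of_to.
      + exists T. split; [easy|]. split.
        * intros x Hx. apply HT1. now apply Him.
        * intros x Hx. apply HT2. now apply Him. }
  destruct Hlim as [a Ha].
  destruct (Hu (fs a)) as [[m Hm]|(x & Hx & HU)].
  { apply (Ha m). exists (fun _ => False). split; [borel|]. split.
    - intros x (b & Hb & Hx). now apply (Hm b Hb x).
    - tauto. }
  destruct (Hu' (sn a)) as [[m Hm]|(y & Hy & HU')].
  { apply (Ha m). exists (fun _ => True). split; [borel|]. split; [easy|].
    intros z (b & Hb & Hz) _. exact (Hm b Hb z Hz). }
  (* Limit points belong to [A] and [A'] themselves, so disjointness makes them distinct. *)
  assert (Hxy : x <> y) by (intros ->; now apply (Hdis y)).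
  destruct (HO x y Hxy) as (U & U' & HOU & HOU' & HUx & HUy & HUU).
  destruct (HU U HOU HUx) as [m Hm]. destruct (HU' U' HOU' HUy) as [n Hn].
  apply (Ha (max m n)). exists U. split; [now apply HOB|]. split.
  - intros z (b & Hb & Hz). apply (Hm b); [|easy]. apply (agree_le _ (max m n)); [lia|easy].
  - intros z (b & Hb & Hz) HUz. apply (HUU z HUz). apply (Hn b); [|easy].
    apply (agree_le _ (max m n)); [lia|easy].
Qed.

End Separation.

(** All that is kept of a Polish space; in this form it passes to products with no product
    metric. *)
Record suslin {X : Type} (B O : (X -> Prop) -> Prop) : Prop := {
  suslin_open : forall U, O U -> B U;
  suslin_hausdorff : hausdorff O;
  suslin_analytic : forall A, B A -> analytic O A }.

(** Only a subbase of the product topology. This is enough, because [usco] and [hausdorff] refer to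
    members of the family and never to their intersections. *)
Definition cylinders {X Y : Type} (OX : (X -> Prop) -> Prop) (OY : (Y -> Prop) -> Prop) :
    (X * Y -> Prop) -> Prop :=
  fun S => (exists U, OX U /\ S = fun p => U (fst p)) \/
           (exists U, OY U /\ S = fun p => U (snd p)).

(** * Products and projections *)

Section Product.
Context {X Y : Type} (BX OX : (X -> Prop) -> Prop) (BY OY : (Y -> Prop) -> Prop).

Lemma cylinders_hausdorff : hausdorff OX -> hausdorff OY -> hausdorff (cylinders OX OY).
Proof.
  intros HX HY [x y] [x' y'] Hne.
  destruct (classic (x = x')) as [<-|Hx].
  - assert (Hy : y <> y') by congruence.
    destruct (HY y y' Hy) as (U & U' & HU & HU' & H1 & H2 & Hd).
    exists (fun p => U (snd p)), (fun p => U' (snd p)).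
    repeat split; try easy; [right; now exists U|right; now exists U'|].
    intros [z z']. apply Hd.
  - destruct (HX x x' Hx) as (U & U' & HU & HU' & H1 & H2 & Hd).
    exists (fun p => U (fst p)), (fun p => U' (fst p)).
    repeat split; try easy; [left; now exists U|left; now exists U'|].
    intros [z z']. apply Hd.
Qed.

(** Even terms of a code describe the first coordinate, odd terms the second. *)
Lemma analytic_rect (A : X -> Prop) (A' : Y -> Prop) : analytic OX A -> analytic OY A' ->
  analytic (cylinders OX OY) (fun p => A (fst p) /\ A' (snd p)).
Proof.
  intros (r & HA & Hr) (r' & HA' & Hr').
  set (ev := fun (a : nat -> nat) n => a (2 * n)).
  set (od := fun (a : nat -> nat) n => a (2 * n + 1)).
  exists (fun a p => r (ev a) (fst p) /\ r' (od a) (snd p)). split.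
  - intros [x y]. simpl. split.
    + intros [Hx Hy]. apply HA in Hx as [a Ha]. apply HA' in Hy as [b Hb].
      exists (fun n => if Nat.even n then a (Nat.div2 n) else b (Nat.div2 n)).
      replace (ev _) with a; [replace (od _) with b; [easy|]|];
        apply functional_extensionality; intros n; unfold ev, od.
      * rewrite Nat.add_1_r, Nat.even_succ, <- Nat.negb_even, Nat.even_mul.
        simpl negb. now rewrite Nat.div2_succ_double.
      * rewrite Nat.even_mul. simpl orb. now rewrite Nat.div2_double.
    + intros (a & Hx & Hy). split; [apply HA|apply HA']; eauto.
  - intros a.
    assert (Hev : forall m, exists m', forall b, agree m' a b -> agree m (ev a) (ev b)).
    { intros m. destruct (agree_reindex (fun n => 2 * n) m) as [m' Hm'].
      exists m'. intros b. apply Hm'. }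
    assert (Hod : forall m, exists m', forall b, agree m' a b -> agree m (od a) (od b)).
    { intros m. destruct (agree_reindex (fun n => 2 * n + 1) m) as [m' Hm'].
      exists m'. intros b. apply Hm'. }
    destruct (Hr (ev a)) as [[m Hm]|(x & Hx & HU)].
    { left. destruct (Hev m) as [m' Hm']. exists m'. intros b Hb p [Hp _].
      now apply (Hm _ (Hm' b Hb) (fst p)). }
    destruct (Hr' (od a)) as [[m Hm]|(y & Hy & HU')].
    { left. destruct (Hod m) as [m' Hm']. exists m'. intros b Hb p [_ Hp].
      now apply (Hm _ (Hm' b Hb) (snd p)). }
    right. exists (x, y). split; [easy|].
    intros S [(U & HOU & ->)|(U & HOU & ->)] HS; simpl in HS.
    + destruct (HU U HOU HS) as [m Hm]. destruct (Hev m) as [m' Hm']. exists m'.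
      intros b Hb p [Hp _]. now apply (Hm _ (Hm' b Hb)).
    + destruct (HU' U HOU HS) as [m Hm]. destruct (Hod m) as [m' Hm']. exists m'.
      intros b Hb p [_ Hp]. now apply (Hm _ (Hm' b Hb)).
Qed.

Lemma suslin_prod `{SigmaAlgebra X BX} `{SigmaAlgebra Y BY} :
  suslin BX OX -> suslin BY OY -> suslin (psigma BX BY) (cylinders OX OY).
Proof.
  intros [OBX hX aX] [OBY hY aY]. split.
  - intros S [(U & HU & ->)|(U & HU & ->)].
    + apply meas_fst; [easy|]. now apply OBX.
    + apply meas_snd; [easy|]. now apply OBY.
  - now apply cylinders_hausdorff.
  - intros A HA.
    assert (HT : forall A1 A2, BX A1 -> BY A2 ->
              analytic (cylinders OX OY) (fun p => A1 (fst p) /\ A2 (snd p))).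
    { intros A1 A2 H1 H2. apply analytic_rect; auto. }
    refine (proj1 (sigma_gen_bianalytic (cylinders OX OY) _ _ _ _ A HA)).
    + now apply cylinders_hausdorff.
    + apply (analytic_ext _ (fun p => True /\ True)); [|tauto].
      apply (HT (fun _ => True) (fun _ => True)); borel.
    + intros S (A1 & A2 & H1 & H2 & HS). split.
      * apply (analytic_ext _ _ _ (HT A1 A2 H1 H2)). intros p. now rewrite HS.
      (* The complement of a rectangle is a union of two rectangles. *)
      * apply (analytic_ext _ (fun p => (~ A1 (fst p) /\ True) \/ (True /\ ~ A2 (snd p)))).
        -- apply analytic_or.
           ++ apply (HT (fun x => ~ A1 x) (fun _ => True)); borel.
           ++ apply (HT (fun _ => True) (fun x => ~ A2 x)); borel.
        -- intros p. rewrite HS. tauto.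
Qed.

(** Composing the parametrization with the projection keeps it [usco], since an open set of [X]
    pulls back to a cylinder. *)
Lemma analytic_proj (E : X * Y -> Prop) :
  analytic (cylinders OX OY) E -> analytic OX (fun x => exists y, E (x, y)).
Proof.
  intros (r & HE & Hr). exists (fun a x => exists y, r a (x, y)). split.
  - intros x. split.
    + intros [y Hy]. apply HE in Hy as [a Ha]. now exists a, y.
    + intros (a & y & Hy). exists y. apply HE. now exists a.
  - intros a. destruct (Hr a) as [[m Hm]|([x y] & Hxy & HU)].
    + left. exists m. intros b Hb x [y Hy]. now apply (Hm b Hb (x, y)).
    + right. exists x. split; [now exists y|]. intros U HOU HUx.
      destruct (HU (fun p => U (fst p))) as [m Hm]; [left; now exists U|easy|].
      exists m. intros b Hb x' [y' Hy']. now apply (Hm b Hb (x', y')).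
Qed.

End Product.

(** * Polish spaces *)

Section Polish.
Context {V : Type} (d : V -> V -> R) (Hmetric : is_metric d) (Hcomplete : complete_metric d)
  (s : nat -> option V)
  (Hdense : forall x eps, (0 < eps)%R -> exists n y, s n = Some y /\ (d x y < eps)%R).

Local Open Scope R_scope.

Definition radius (n : nat) : R := / INR (S n).

Lemma radius_pos n : 0 < radius n.
Proof. apply Rinv_0_lt_compat, lt_0_INR. lia. Qed.

Lemma radius_le m n : (m <= n)%nat -> radius n <= radius m.
Proof. intros H. apply Rinv_le_contravar; [apply lt_0_INR; lia|apply le_INR; lia]. Qed.

Lemma radius_small eps : 0 < eps -> exists n, forall m, (n <= m)%nat -> radius m < eps.
Proof.
  intros H. destruct (archimed_cor1 eps H) as (N & HN & Hpos). exists N. intros m Hm.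
  apply Rle_lt_trans with (/ INR N); [|easy].
  apply Rinv_le_contravar; [apply lt_0_INR; lia|apply le_INR; lia].
Qed.

Lemma le_of_radius x y c : 0 < c -> (forall n, x <= y + c * radius n) -> x <= y.
Proof.
  intros Hc H. apply Rnot_lt_le. intros Hlt.
  destruct (radius_small ((x - y) / c)) as [n Hn].
  { apply Rdiv_lt_0_compat; lra. }
  specialize (Hn n (le_n n)). specialize (H n).
  apply (Rmult_lt_compat_l c) in Hn; [|easy].
  replace (c * ((x - y) / c)) with (x - y) in Hn by (field; lra). lra.
Qed.

Lemma metric_refl x : d x x = 0.
Proof. now apply Hmetric. Qed.

Lemma metric_sym x y : d x y = d y x.
Proof. apply Hmetric. Qed.

Lemma metric_tri x y z : d x z <= d x y + d y z.
Proof. apply Hmetric. Qed.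

Lemma metric_pos x y : x <> y -> 0 < d x y.
Proof.
  intros Hne. destruct Hmetric as (H0 & H1 & _). destruct (H0 x y) as [H|H]; [easy|].
  exfalso. apply Hne. now apply H1.
Qed.

(** Empty when the dense enumeration has a gap at [i]. *)
Definition near (i j : nat) (x : V) : Prop :=
  exists c, s i = Some c /\ d x c < radius j.

Lemma near_open i j : metric_open d (near i j).
Proof.
  intros x (c & Hc & Hx). exists (radius j - d x c). split; [lra|].
  intros y Hy. exists c. split; [easy|].
  pose proof (metric_tri y x c). rewrite (metric_sym y x) in *. lra.
Qed.

Lemma near_cover x j : exists i, near i j x.
Proof.
  destruct (Hdense x (radius j) (radius_pos j)) as (i & c & Hc & Hd). now exists i, c.
Qed.

Lemma near_dist i j x y : near i j x -> near i j y -> d x y < 2 * radius j.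
Proof.
  intros (c & Hc & Hx) (c' & Hc' & Hy). assert (c' = c) as -> by congruence.
  pose proof (metric_tri x c y). rewrite (metric_sym c y) in *. lra.
Qed.

(** A condition on the centers alone, implied by a common point of the two balls. It does not
    mention that point, so it is a constant in measurability arguments. *)
Definition consistent (i j i' j' : nat) : Prop :=
  exists c c', s i = Some c /\ s i' = Some c' /\ d c c' <= radius j + radius j'.

(** Centers of selected balls with shrinking radii form a Cauchy sequence, and its limit lies in all
    the closed balls. A relation is used because several balls of one radius may be selected. *)
Lemma consistent_limit (b : nat -> nat -> Prop) :
  (forall j, exists i, b i j) ->
  (forall i j i' j', b i j -> b i' j' -> consistent i j i' j') ->
  exists x, forall i j, b i j -> exists c, s i = Some c /\ d x c <= radius j.
Proof.
  intros Hex Hcons.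
  assert (Hc : forall j, exists c i, b i j /\ s i = Some c).
  { intros j. destruct (Hex j) as [i Hi].
    destruct (Hcons i j i j Hi Hi) as (c & _ & Hc & _). now exists c, i. }
  destruct (choice _ Hc) as [c Hcs].
  assert (Hcc : forall j j', d (c j) (c j') <= radius j + radius j').
  { intros j j'. destruct (Hcs j) as (i & Hi & Hsi). destruct (Hcs j') as (i' & Hi' & Hsi').
    destruct (Hcons i j i' j' Hi Hi') as (e & e' & He & He' & Hd).
    assert (e = c j) as -> by congruence. assert (e' = c j') as -> by congruence. easy. }
  destruct (Hcomplete c) as [x Hx].
  { intros eps Heps. destruct (radius_small (eps / 2)) as [N HN]; [lra|].
    exists N. intros m n Hm Hn. specialize (Hcc m n).
    pose proof (HN m Hm). pose proof (HN n Hn). lra. }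
  exists x. intros i j Hi.
  destruct (Hcons i j i j Hi Hi) as (e & _ & He & _). exists e. split; [easy|].
  apply (le_of_radius _ _ 2); [lra|]. intros n.
  destruct (Hx (radius n) (radius_pos n)) as [N HN].
  set (m := max n N). specialize (HN m ltac:(lia)).
  destruct (Hcs m) as (i' & Hi' & Hsi').
  destruct (Hcons i' m i j Hi' Hi) as (f & f' & Hf & Hf' & Hd).
  assert (f = c m) as -> by congruence. assert (f' = e) as -> by congruence.
  pose proof (metric_tri x (c m) e). rewrite (metric_sym x (c m)) in *.
  pose proof (radius_le n m ltac:(lia)). lra.
Qed.

Lemma metric_hausdorff : hausdorff (metric_open d).
Proof.
  intros x y Hne. pose proof (metric_pos x y Hne) as Hpos.
  assert (Hball : forall z r, metric_open d (fun w => d z w < r)).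
  { intros z r w Hw. exists (r - d z w). split; [lra|]. intros v Hv.
    pose proof (metric_tri z w v). lra. }
  exists (fun w => d x w < d x y / 2), (fun w => d y w < d x y / 2).
  repeat split; try apply Hball; rewrite ?metric_refl; try lra.
  intros z Hz Hz'. pose proof (metric_tri x z y). rewrite (metric_sym y z) in *. lra.
Qed.

(** A sequence [a] codes the point lying in all balls [near (a j) j]. Consistent centers converge by
    completeness; an inconsistent pair shows on a finite initial segment and rules out every
    point. *)
Lemma polish_analytic : analytic (metric_open d) (fun _ : V => True).
Proof.
  exists (fun a x => forall j, near (a j) j x). split.
  - intros x. split; [|easy]. intros _.
    apply (choice (fun j i => near i j x)). intros j. apply near_cover.
  - intros a.
    destruct (classic (forall j j', consistent (a j) j (a j') j')) as [Hc|Hc].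
    + right. destruct (consistent_limit (fun i j => i = a j)) as [x Hx].
      * intros j. now exists (a j).
      * intros i j i' j' -> ->. apply Hc.
      * exists x. split; [easy|]. intros U HU HUx. destruct (HU x HUx) as (eps & Heps & HUe).
        destruct (radius_small (eps / 2)) as [N HN]; [lra|]. exists (S N).
        intros b Hb y Hy. apply HUe. specialize (Hy N). rewrite <- (Hb N) in Hy by lia.
        destruct Hy as (c & Hsc & Hyc).
        destruct (Hx (a N) N eq_refl) as (c' & Hsc' & Hxc).
        assert (c' = c) as -> by congruence.
        specialize (HN N (le_n N)).
        pose proof (metric_tri x c y). rewrite (metric_sym c y) in *. lra.
    + left. apply not_all_ex_not in Hc as [j Hc]. apply not_all_ex_not in Hc as [j' Hc].
      exists (S (max j j')). intros b Hb y Hy. apply Hc.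
      pose proof (Hy j) as (c & Hs & Hd). pose proof (Hy j') as (c' & Hs' & Hd').
      rewrite <- (Hb j) in Hs by lia. rewrite <- (Hb j') in Hs' by lia.
      exists c, c'. repeat split; try easy.
      pose proof (metric_tri c y c'). rewrite (metric_sym c y) in *. lra.
Qed.

Lemma polish_suslin : suslin (sigma_gen (metric_open d)) (metric_open d).
Proof.
  split.
  - apply sg_base.
  - apply metric_hausdorff.
  - intros A HA. refine (proj1 (sigma_gen_bianalytic (metric_open d) _ _ _ _ A HA)).
    + apply metric_hausdorff.
    + apply polish_analytic.
    + assert (Hclosed : forall C : V -> Prop, metric_open d (fun x => ~ C x) ->
                analytic (metric_open d) C).
      { intros C HC. apply (analytic_ext _ (fun x => True /\ C x)); [|tauto].
        apply analytic_closed; [|apply polish_analytic].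
        intros x Hx. exists (fun x => ~ C x). easy. }
      intros U HU. split.
      (* An open set is a countable union of closed sets: the points whose ball of radius [radius n]
         stays inside it. *)
      * apply (analytic_ext _ (fun x => exists n, forall y, d x y < radius n -> U y)).
        -- apply analytic_ex. intros n. apply Hclosed. intros x Hx.
           apply not_all_ex_not in Hx as [y Hy]. apply imply_to_and in Hy as [Hy HUy].
           exists (radius n - d x y). split; [lra|]. intros z Hz Hz'. apply HUy, Hz'.
           pose proof (metric_tri z x y). rewrite (metric_sym z x) in *. lra.
        -- intros x. split.
           ++ intros [n Hn]. apply Hn. rewrite metric_refl. apply radius_pos.
           ++ intros HUx. destruct (HU x HUx) as (eps & Heps & Hy).
              destruct (radius_small eps Heps) as [n Hn]. exists n. intros y Hd.
              apply Hy. specialize (Hn n (le_n n)). lra.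
      * apply Hclosed. intros x Hx. destruct (HU x) as (eps & Heps & Hy); [now apply NNPP|].
        exists eps. split; [easy|]. intros y Hd HUy. apply HUy. now apply Hy.
Qed.

(* The coordinates of the unique [y] in the section of [x] are read off the sets [b i j]
   separating the projections of [E] restricted to a ball and to its complement. *)
Lemma borel_proj_partial_function {X : Type} (BX OX : (X -> Prop) -> Prop)
    `{SigmaAlgebra X BX} (E : X * V -> Prop) :
  suslin BX OX ->
  psigma BX (sigma_gen (metric_open d)) E ->
  (forall x y y', E (x, y) -> E (x, y') -> y = y') ->
  BX (fun x => exists y, E (x, y)).
Proof.
  intros HX HE Huniq. set (BV := sigma_gen (metric_open d)) in *.
  assert (Hnear : forall i j, BV (near i j)).
  { intros i j. apply sg_base, near_open. }
  assert (HXV : suslin (psigma BX BV) (cylinders OX (metric_open d))).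
  { apply suslin_prod; try exact _; [easy|apply polish_suslin]. }
  assert (Hproj : forall A, BV A ->
            analytic OX (fun x => exists y, E (x, y) /\ A y)).
  { intros A HA. apply (analytic_proj OX (metric_open d) (fun p => E p /\ A (snd p))).
    apply (suslin_analytic _ _ HXV).
    apply (sa_and (psigma BX BV)); [easy|]. now apply (meas_snd BX BV). }
  assert (Hsep : forall p : nat * nat, exists S, BX S /\
            (forall x, (exists y, E (x, y) /\ near (fst p) (snd p) y) -> S x) /\
            (forall x, (exists y, E (x, y) /\ ~ near (fst p) (snd p) y) -> ~ S x)).
  { intros [i j].
    apply (analytic_separation BX OX).
    - apply (suslin_hausdorff _ _ HX).
    - apply (suslin_open _ _ HX).
    - apply Hproj, Hnear.
    - apply (Hproj (fun y => ~ near i j y)). apply sa_not, Hnear.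
    - intros x (y & Hy & Hn) (y' & Hy' & Hn').
      apply Hn'. now rewrite (Huniq x y' y Hy' Hy). }
  destruct (choice _ Hsep) as [b0 Hb0]. set (b := fun i j => b0 (i, j)).
  assert (Hb : forall i j, BX (b i j)) by (intros i j; apply (Hb0 (i, j))).
  assert (Hbnear : forall x y i j, E (x, y) -> b i j x <-> near i j y).
  { intros x y i j Hxy. destruct (Hb0 (i, j)) as (_ & H1 & H2). split.
    - intros Hbx. apply NNPP. intros Hn. apply (H2 x); [|easy]. now exists y.
    - intros Hn. apply H1. now exists y. }
  destruct (classic (exists v : V, True)) as [[v0 _]|Hempty].
  2: { apply (sa_ext (fun _ => False)); [apply sa_empty|].
       intros x. split; [easy|]. intros [y _]. apply Hempty. now exists y. }
  (* At points of [W] the separating sets look like the coordinates of some point. [W] is Borel and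
     contains the projection; off [W] the map [f] below takes the default value [v0]. *)
  set (W := fun x => (forall j, exists i, b i j x) /\
              forall i j i' j', b i j x -> b i' j' x -> consistent i j i' j').
  assert (HW : BX W).
  { unfold W. apply sa_and; [exact _| |].
    - apply (sa_all BX (fun j x => exists i, b i j x)). intros j. now apply sa_ex.
    - borel; apply Hb. }
  assert (HE0 : forall x y, E (x, y) -> W x).
  { intros x y Hxy. split.
    - intros j. destruct (near_cover y j) as [i Hi]. exists i. now apply (Hbnear x y).
    - intros i j i' j' H1 H2. apply (Hbnear x y) in H1 as (c & Hc & Hd); [|easy].
      apply (Hbnear x y) in H2 as (c' & Hc' & Hd'); [|easy].
      exists c, c'. repeat split; try easy.
      pose proof (metric_tri c y c'). rewrite (metric_sym c y) in *. lra. }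
  destruct (choice (fun x y => (W x -> forall i j, b i j x ->
              exists c, s i = Some c /\ d y c <= radius j) /\ (~ W x -> y = v0)))
    as [f Hf].
  { intros x. destruct (classic (W x)) as [Hx|Hx].
    - destruct (consistent_limit (fun i j => b i j x)) as [y Hy]; [apply Hx|apply Hx|].
      now exists y.
    - now exists v0. }
  assert (Hfm : meas BX BV f).
  { apply meas_gen; [easy|]. intros U HU.
    (* On [W], [f x] lies in [U] exactly when some selected closed ball is contained in [U]. *)
    apply (sa_ext (fun x => (W x /\ exists i j, b i j x /\
             (forall c z, s i = Some c -> d z c <= radius j -> U z)) \/ (~ W x /\ U v0))).
    - borel; apply Hb.
    - intros x. split.
      + intros [[Hx (i & j & Hij & HUij)]|[Hx HUx]].
        * destruct (proj1 (Hf x) Hx i j Hij) as (c & Hc & Hd). now apply (HUij c).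
        * now rewrite (proj2 (Hf x) Hx).
      + intros HUx. destruct (classic (W x)) as [Hx|Hx].
        2: { right. split; [easy|]. now rewrite <- (proj2 (Hf x) Hx). }
        left. split; [easy|]. destruct (HU _ HUx) as (eps & Heps & HUe).
        destruct (radius_small (eps / 2)) as [j Hj]; [lra|].
        destruct (proj1 Hx j) as [i Hi]. exists i, j. split; [easy|].
        intros c z Hc Hz. apply HUe.
        destruct (proj1 (Hf x) Hx i j Hi) as (c' & Hc' & Hd).
        assert (c' = c) as -> by congruence.
        specialize (Hj j (le_n j)).
        pose proof (metric_tri (f x) c z). rewrite (metric_sym c z) in *. lra. }
  (* Membership in [W] does not ensure a point in the section, so [E] is tested at the candidate
     [f x]. *)
  apply (sa_ext (fun x => W x /\ E (x, f x))).
  - apply sa_and; [exact _|easy|].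
    apply (meas_pair BX BX BV (fun x => x) f (meas_id BX) Hfm E HE).
  - intros x. split; [intros [_ HEx]; now exists (f x)|].
    intros [y Hy]. pose proof (HE0 x y Hy) as Hx. split; [easy|].
    replace (f x) with y; [easy|]. apply NNPP. intros Hne.
    pose proof (metric_pos y (f x) Hne) as Hpos.
    (* For every [j], both points are within [radius j] of a common center. *)
    enough (d y (f x) <= 0) by lra.
    apply (le_of_radius _ _ 2); [lra|]. intros j.
    destruct (near_cover y j) as [i Hi].
    destruct (proj1 (Hf x) Hx i j) as (c & Hc & Hd); [now apply (Hbnear x y)|].
    destruct Hi as (c' & Hc' & Hd'). assert (c' = c) as -> by congruence.
    pose proof (metric_tri y c (f x)). rewrite (metric_sym c (f x)) in *. lra.
Qed.

End Polish.

(** * Borel relations with bounded sections *)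

(** The list may contain further elements, so the same list serves for subrelations. *)
Definition covered {X Y : Type} (N : nat) (R : X -> Y -> Prop) : Prop :=
  forall x, exists l : list Y, length l <= N /\ forall y, R x y -> In y l.

Lemma covered_sub {X Y : Type} N (R S : X -> Y -> Prop) :
  (forall x y, R x y -> S x y) -> covered N S -> covered N R.
Proof. intros HRS HS x. destruct (HS x) as (l & Hl & Hin). exists l. firstorder. Qed.

Lemma covered_comp {X Y Z : Type} N M (R : X -> Y -> Prop) (S : Y -> Z -> Prop) :
  covered N R -> covered M S -> covered (N * M) (fun x z => exists y, R x y /\ S y z).
Proof.
  intros HR HS x. destruct (HR x) as (l & Hl & Hin). destruct (choice _ HS) as [g Hg].
  exists (flat_map g l). split.
  - clear Hin. revert N HR Hl. induction l as [|y l IH]; intros N HR Hl; simpl; [lia|].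
    rewrite length_app. simpl in Hl. destruct N as [|N]; [lia|].
    assert (length (flat_map g l) <= N * M).
    { clear -Hg Hl. apply le_S_n in Hl. revert N Hl.
      induction l as [|z l IH]; intros N Hl; simpl; [lia|]. rewrite length_app.
      simpl in Hl. destruct N as [|N]; [lia|]. specialize (IH N ltac:(lia)).
      pose proof (proj1 (Hg z)). simpl. lia. }
    pose proof (proj1 (Hg y)). simpl. lia.
  - intros z (y & Hy & Hz). apply in_flat_map. exists y. split; [now apply Hin|].
    now apply Hg.
Qed.

Definition natmeas {X : Type} (BX : (X -> Prop) -> Prop) (c : X -> nat) : Prop :=
  forall i, BX (fun x => c x = i).

(** What remains of a countable base of small balls; it turns inequality and finiteness of
    neighborhoods into countable conditions. *)
Definition isolating {V : Type} (a : nat -> V -> Prop) : Prop :=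
  forall x l, exists n, a n x /\ forall y, In y l -> a n y -> y = x.

(** The base space is quantified because the induction on the section bound replaces [X] by
    [X * V]. *)
Definition narrow_projections {V : Type} (B : (V -> Prop) -> Prop) : Prop :=
  forall (X : Type) (BX OX : (X -> Prop) -> Prop) (E : X * V -> Prop),
    SigmaAlgebra BX -> suslin BX OX -> psigma BX B E ->
    (forall x y y', E (x, y) -> E (x, y') -> y = y') ->
    BX (fun x => exists y, E (x, y)).

(** From here on the metric is used only through these four facts. *)
Lemma standard_borel_structure {V : Type} (B : (V -> Prop) -> Prop) : standard_borel B ->
  SigmaAlgebra B /\ (exists O, suslin B O) /\ narrow_projections B /\
  exists a : nat -> V -> Prop, (forall n, B (a n)) /\ isolating a.
Proof.
  intros (d & (Hm & Hc & s & Hs) & HB).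
  assert (B = sigma_gen (metric_open d)) as ->.
  { apply functional_extensionality. intros A.
    apply propositional_extensionality, HB. }
  split; [exact _|]. split; [|split].
  - exists (metric_open d). now apply (polish_suslin d Hm Hc s).
  - intros X BX OX E H. now apply (borel_proj_partial_function d Hm Hc s).
  - exists (fun n => near d s (fst (of_nat n)) (snd (of_nat n))). split.
    + intros n. apply sg_base. now apply near_open.
    + intros x l.
      assert (He : exists eps, (0 < eps)%R /\ forall y, In y l -> (d x y < eps)%R -> y = x).
      { induction l as [|z l (eps & Heps & IH)].
        - exists 1%R. split; [lra|easy].
        - destruct (classic (z = x)) as [->|Hne].
          + exists eps. split; [easy|]. intros y [<-|Hy]; [easy|]. now apply IH.
          + exists (Rmin eps (d x z)). split.
            * apply Rmin_pos; [easy|]. apply (metric_pos d Hm). congruence.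
            * intros y [<-|Hy] Hd.
              -- pose proof (Rmin_r eps (d x z)). lra.
              -- apply IH; [easy|]. pose proof (Rmin_l eps (d x z)). lra. }
      destruct He as (eps & Heps & He).
      destruct (radius_small (eps / 2)) as [j Hj]; [lra|].
      destruct (near_cover d s Hs x j) as [i Hi].
      exists (to_nat (i, j)). rewrite cancel_of_to. simpl. split; [easy|].
      intros y Hy Hn. apply He; [easy|].
      pose proof (near_dist d Hm s i j x y Hi Hn). specialize (Hj j (le_n j)). lra.
Qed.

Section StandardBorel.
Context {V : Type} (B : (V -> Prop) -> Prop) (HV : standard_borel B).

#[local] Instance standard_borel_algebra : SigmaAlgebra B.
Proof. apply (standard_borel_structure B HV). Qed.

Lemma isolating_neq (a : nat -> V -> Prop) : isolating a ->
  forall x y, x <> y <-> exists n, a n x /\ ~ a n y.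
Proof.
  intros Ha x y. split.
  - intros Hne. destruct (Ha x (y :: nil)) as (n & Hx & Hy). exists n. split; [easy|].
    intros Hn. apply Hne. symmetry. apply Hy; [now left|easy].
  - intros (n & Hx & Hy) ->. easy.
Qed.

(** Inequality is a countable union of conditions on [f] and [g] separately. *)
Lemma borel_neq {X : Type} (BX : (X -> Prop) -> Prop) `{SigmaAlgebra X BX} (f g : X -> V) :
  meas BX B f -> meas BX B g -> BX (fun x => f x <> g x).
Proof.
  intros Hf Hg. destruct (standard_borel_structure B HV) as (_ & _ & _ & a & HaB & Ha).
  apply (sa_ext (fun x => exists n, a n (f x) /\ ~ a n (g x))).
  - borel; [now apply Hf|now apply Hg].
  - intros x. now rewrite isolating_neq.
Qed.

Lemma borel_eq {X : Type} (BX : (X -> Prop) -> Prop) `{SigmaAlgebra X BX} (f g : X -> V) :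
  meas BX B f -> meas BX B g -> BX (fun x => f x = g x).
Proof.
  intros Hf Hg. apply (sa_ext (fun x => ~ f x <> g x)).
  - now apply sa_not, borel_neq.
  - intros x. split; [apply NNPP|tauto].
Qed.

(* The points whose section has a single element in a small ball form a set with sections of
   size at most one; the complementary condition is a projection with fewer points. *)
Lemma borel_proj_covered (N : nat) : forall (X : Type) (BX OX : (X -> Prop) -> Prop)
    (E : X -> V -> Prop), SigmaAlgebra BX -> suslin BX OX ->
  psigma BX B (fun p => E (fst p) (snd p)) -> covered N E -> BX (fun x => exists y, E x y).
Proof.
  destruct (standard_borel_structure B HV) as (_ & (O & HO) & Hproj & a & HaB & Ha).
  induction N as [|N IH]; intros X BX OX E HX Hsus HE Hcov.
  { apply (sa_ext (fun _ => False)); [apply sa_empty|].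
    intros x. split; [easy|]. intros [y Hy]. destruct (Hcov x) as (l & Hl & Hin).
    apply Hin in Hy. destruct l; [easy|simpl in Hl; lia]. }
  set (BXV := psigma BX B).
  (* For [y] in the section of [x] and in [a n], these are the other points of that section in
     [a n]. Leaving out [y] lowers the bound to [N]. *)
  set (T := fun n (p : X * V) y => E (fst p) (snd p) /\ E (fst p) y /\
              a n (snd p) /\ a n y /\ snd p <> y).
  assert (HT : forall n, BXV (fun p => exists y, T n p y)).
  { intros n. apply (IH (X * V)%type BXV (cylinders OX O)); [exact _| | |].
    - apply suslin_prod; try exact _; easy.
    - set (B3 := psigma BXV B).
      assert (M1 : meas B3 BXV fst) by (apply meas_fst; exact _).
      assert (M2 : meas B3 B snd) by (apply meas_snd; exact _).
      assert (M3 : meas B3 BX (fun q => fst (fst q))).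
      { apply (meas_comp B3 BXV BX fst); [apply meas_fst; exact _|easy]. }
      assert (M4 : meas B3 B (fun q => snd (fst q))).
      { apply (meas_comp B3 BXV B snd); [apply meas_snd; exact _|easy]. }
      pose proof (meas_pair B3 BX B _ _ M3 M2 _ HE) as H1.
      pose proof (M1 _ HE) as H2.
      unfold T. borel.
      + now apply M4.
      + now apply M2.
      + exact (borel_eq B3 _ _ M4 M2).
    - intros [x y]. destruct (Hcov x) as (l & Hl & Hin).
      destruct (classic (E x y)) as [Hxy|Hxy].
      2: { exists nil. split; [simpl; lia|]. intros y' [H _]. easy. }
      apply Hin in Hxy. apply in_split in Hxy as (l1 & l2 & ->).
      exists (l1 ++ l2). rewrite !length_app in *. simpl in *. split; [lia|].
      intros y' (_ & Hy' & _ & _ & Hne). apply Hin in Hy'.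
      rewrite in_app_iff in *. simpl in *. intuition congruence. }
  (* Some [a n] isolates a given point within its finite section. For fixed [n] at most one point of
     the section is alone in [a n], so the uniqueness case applies. *)
  apply (sa_ext (fun x => exists n y, E x y /\ a n y /\ ~ exists y', T n (x, y) y')).
  - apply sa_ex. intros n.
    apply (Hproj X BX OX (fun p => E (fst p) (snd p) /\ a n (snd p) /\ ~ exists y', T n p y'));
      [easy|easy| |].
    + assert (M : meas BXV B snd) by (apply meas_snd; exact _).
      change (BXV (fun p => E (fst p) (snd p) /\ a n (snd p) /\ ~ exists y', T n p y')).
      specialize (HT n). apply (sa_and BXV); [easy|]. apply (sa_and BXV).
      * apply (M _ (HaB n)).
      * now apply sa_not.
    + simpl. intros x y y' (Hy & Hay & HTy) (Hy' & Hay' & HTy').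
      apply NNPP. intros Hne. apply HTy. now exists y'.
  - intros x. split; [intros (n & y & Hy & _); now exists y|]. intros [y Hy].
    destruct (Hcov x) as (l & _ & Hin). destruct (Ha y l) as (n & Hn & Hiso).
    exists n, y. repeat split; try easy. intros (y' & _ & Hy' & _ & Han & Hne).
    apply Hne. symmetry. apply Hiso; [now apply Hin|easy].
Qed.

Definition brel (R : V -> V -> Prop) : Prop := psigma B B (fun p => R (fst p) (snd p)).

Lemma brel_image N (R : V -> V -> Prop) (U : V -> Prop) :
  brel R -> covered N R -> B U -> B (fun x => exists y, R x y /\ U y).
Proof.
  intros HR Hcov HU. destruct (standard_borel_structure B HV) as (_ & (O & HO) & _).
  apply (borel_proj_covered N V B O (fun x y => R x y /\ U y)); [exact _|easy| |].
  - apply (sa_and (psigma B B)); [easy|]. now apply (meas_snd B B).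
  - intros x. destruct (Hcov x) as (l & Hl & Hin). exists l. firstorder.
Qed.

(** The composition is a projection of a Borel subset of [(V * V) * V], whose sections are bounded
    through [R]. *)
Lemma brel_comp N (R S : V -> V -> Prop) : brel R -> covered N R -> brel S ->
  brel (fun x z => exists y, R x y /\ S y z).
Proof.
  intros HR Hcov HS. destruct (standard_borel_structure B HV) as (_ & (O & HO) & _).
  apply (borel_proj_covered N (V * V) (psigma B B) (cylinders O O)
           (fun p y => R (fst p) y /\ S y (snd p))); [exact _| | |].
  - apply suslin_prod; try exact _; easy.
  - set (B3 := psigma (psigma B B) B).
    assert (M1 : meas B3 (psigma B B) fst) by (apply meas_fst; exact _).
    assert (M2 : meas B3 B snd) by (apply meas_snd; exact _).
    assert (M3 : meas B3 B (fun q => fst (fst q))).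
    { apply (meas_comp B3 (psigma B B) B fst); [apply meas_fst; exact _|easy]. }
    assert (M4 : meas B3 B (fun q => snd (fst q))).
    { apply (meas_comp B3 (psigma B B) B snd); [apply meas_snd; exact _|easy]. }
    apply (sa_and B3).
    + apply (meas_pair B3 B B _ _ M3 M2 _ HR).
    + apply (meas_pair B3 B B _ _ M2 M4 _ HS).
  - intros [x z]. destruct (Hcov x) as (l & Hl & Hin). exists l. firstorder.
Qed.

Lemma brel_and (R S : V -> V -> Prop) : brel R -> brel S -> brel (fun x y => R x y /\ S x y).
Proof. apply (sa_and (psigma B B)). Qed.

Lemma brel_or (R S : V -> V -> Prop) : brel R -> brel S -> brel (fun x y => R x y \/ S x y).
Proof. apply (sa_or (psigma B B)). Qed.

Lemma brel_eq : brel eq.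
Proof. apply (borel_eq (psigma B B)); [apply meas_fst|apply meas_snd]; exact _. Qed.

Lemma brel_neq : brel (fun x y => x <> y).
Proof. apply (borel_neq (psigma B B)); [apply meas_fst|apply meas_snd]; exact _. Qed.

Lemma brel_fst (U : V -> Prop) : B U -> brel (fun x _ => U x).
Proof. apply (meas_fst B B). Qed.

Lemma brel_snd (U : V -> Prop) : B U -> brel (fun _ y => U y).
Proof. apply (meas_snd B B). Qed.

Lemma natmeas_pred (c : V -> nat) (P : nat -> V -> Prop) :
  natmeas B c -> (forall i, B (P i)) -> B (fun x => P (c x) x).
Proof.
  intros Hc HP. apply (sa_ext (fun x => exists i, c x = i /\ P i x)).
  - borel; [apply Hc|apply HP].
  - intros x. split; [now intros (i & <- & Hi)|]. intros Hx. now exists (c x).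
Qed.

Lemma natmeas_glue (c : V -> nat) (f : nat -> V -> V) :
  natmeas B c -> (forall i, meas B B (f i)) -> meas B B (fun x => f (c x) x).
Proof.
  intros Hc Hf S HS. apply (natmeas_pred c (fun i x => S (f i x)) Hc).
  intros i. now apply Hf.
Qed.

(** [C n] holds the points that [a n] isolates from their neighbors, so it is independent.
    Neighborhoods being finite, these sets cover [V], and adding them greedily one after another
    gives a maximal set. *)
Lemma maximal_independent N (H : V -> V -> Prop) :
  brel H -> covered N H -> (forall x y, H x y -> H y x) -> (forall x, ~ H x x) ->
  exists S, B S /\ (forall x y, S x -> S y -> ~ H x y) /\
    forall x, S x \/ exists y, H x y /\ S y.
Proof.
  intros HH Hcov Hsym Hirr.
  destruct (standard_borel_structure B HV) as (_ & _ & _ & a & HaB & Ha).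
  set (C := fun n x => a n x /\ ~ exists y, H x y /\ a n y).
  set (T := fix T n := match n with
    | 0 => fun _ => False
    | S n => fun x => T n x \/ (C n x /\ ~ exists y, H x y /\ T n y)
    end).
  assert (HT : forall n, B (T n)).
  { induction n as [|n IH]; simpl.
    - apply sa_empty.
    - unfold C. borel; try apply HaB; apply (brel_image N); auto. }
  assert (Hmono : forall n m x, n <= m -> T n x -> T m x).
  { intros n m x Hnm Hx. induction Hnm as [|m Hnm IH]; [easy|]. now left. }
  assert (Hind : forall n x y, T n x -> T n y -> ~ H x y).
  { induction n as [|n IH]; [easy|]. intros x y [Hx|[Hx Hx']] [Hy|[Hy Hy']] HHxy.
    - now apply (IH x y).
    - apply Hy'. exists x. split; [now apply Hsym|easy].
    - apply Hx'. now exists y.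
    - apply (proj2 Hx). exists y. split; [easy|]. apply Hy. }
  exists (fun x => exists n, T n x). split; [|split].
  - now apply sa_ex.
  - intros x y [n Hx] [m Hy]. apply (Hind (max n m)); [apply (Hmono n)|apply (Hmono m)]; auto; lia.
  - intros x. destruct (Hcov x) as (l & _ & Hin). destruct (Ha x l) as (n & Hn & Hiso).
    assert (HC : C n x).
    { split; [easy|]. intros (y & Hy & Hay). apply (Hirr x).
      rewrite <- (Hiso y) at 2; auto. }
    destruct (classic (exists y, H x y /\ T n y)) as [(y & Hy & HTy)|Hno].
    + right. exists y. split; [easy|]. now exists n.
    + left. exists (S n). now right.
Qed.

(** A maximal independent set contains each vertex or one of its neighbors, so deleting it lowers
    the bound by one; it receives the top color. *)
Lemma finite_coloring N : forall H : V -> V -> Prop,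
  brel H -> covered N H -> (forall x y, H x y -> H y x) -> (forall x, ~ H x x) ->
  exists c, natmeas B c /\ (forall x, c x <= N) /\ forall x y, H x y -> c x <> c y.
Proof.
  induction N as [|N IH]; intros H HH Hcov Hsym Hirr.
  - exists (fun _ => 0). split; [|split; [easy|]].
    + intros i. borel.
    + intros x y Hxy. destruct (Hcov x) as (l & Hl & Hin). apply Hin in Hxy.
      destruct l; [easy|simpl in Hl; lia].
  - destruct (maximal_independent (S N) H HH Hcov Hsym Hirr) as (S & HS & Hind & Hmax).
    destruct (IH (fun x y => (H x y /\ ~ S x) /\ ~ S y)) as (c & Hc & HcN & Hprop).
    + apply brel_and; [apply brel_and; [easy|]|].
      * now apply brel_fst, sa_not.
      * now apply brel_snd, sa_not.
    + intros x. destruct (Hmax x) as [Hx|(y & Hy & HSy)].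
      { exists nil. split; [simpl; lia|]. now intros y [[_ Hn] _]. }
      destruct (Hcov x) as (l & Hl & Hin).
      pose proof (Hin y Hy) as Hyl. apply in_split in Hyl as (l1 & l2 & ->).
      exists (l1 ++ l2). rewrite !length_app in *. simpl in *. split; [lia|].
      intros z [[Hz _] HSz]. apply Hin in Hz. rewrite in_app_iff in *. simpl in *.
      intuition congruence.
    + intuition.
    + intros x [[Hx _] _]. now apply (Hirr x).
    + exists (fun x => if excluded_middle_informative (S x) then Datatypes.S N else c x).
      split; [|split].
      * intros i. apply (sa_ext (fun x => (S x /\ Datatypes.S N = i) \/ (~ S x /\ c x = i))).
        -- borel. apply Hc.
        -- intros x. destruct (excluded_middle_informative (S x)); tauto.
      * intros x. destruct (excluded_middle_informative (S x)); [easy|].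
        specialize (HcN x). lia.
      * intros x y Hxy.
        destruct (excluded_middle_informative (S x)) as [Hx|Hx];
          destruct (excluded_middle_informative (S y)) as [Hy|Hy].
        -- exfalso. now apply (Hind x y).
        -- specialize (HcN y). lia.
        -- specialize (HcN x). lia.
        -- now apply Hprop.
Qed.

Lemma least_exists (P : nat -> Prop) : (exists n, P n) ->
  exists n, P n /\ forall k, k < n -> ~ P k.
Proof.
  intros [n Hn]. revert Hn. induction n as [n IH] using lt_wf_ind. intros Hn.
  destruct (classic (exists k, k < n /\ P k)) as [(k & Hk & HPk)|Hno].
  - now apply (IH k).
  - exists n. split; [easy|]. intros k Hk HPk. apply Hno. now exists k.
Qed.

(* [c] labels distinguish the points sharing a value of the retraction [p]. *)
Lemma finite_to_one_retraction N (H : V -> V -> Prop) (U : V -> Prop) :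
  brel H -> covered N H -> (forall x y, H x y -> H y x) -> B U ->
  exists (p : V -> V) (c : V -> nat) (M : nat),
    meas B B p /\ natmeas B c /\ (forall x, c x <= M) /\
    (forall x, (exists y, H x y /\ U y) -> H x (p x) /\ U (p x)) /\
    (forall x x', (exists y, H x y /\ U y) -> (exists y, H x' y /\ U y) ->
       p x = p x' -> c x = c x' -> x = x').
Proof.
  intros HH Hcov Hsym HU.
  (* Distinct points with a common [H]-neighbor get distinct colors. This serves twice: to single
     out a neighbor in [U], and to tell apart points with the same image. *)
  destruct (finite_coloring (N * N) (fun x z => (exists y, H x y /\ H y z) /\ x <> z))
    as (c & Hc & HcM & Hprop).
  - apply brel_and; [|apply brel_neq]. now apply (brel_comp N).
  - apply (covered_sub _ _ (fun x z => exists y, H x y /\ H y z)); [tauto|].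
    now apply covered_comp.
  - intros x z [(y & H1 & H2) Hne]. split; [|congruence]. exists y. auto.
  - tauto.
  - set (Q := fun x y => H x y /\ U y /\ forall i, (exists y', H x y' /\ (U y' /\ c y' = i)) ->
                c y <= i).
    assert (HQ : brel Q).
    { unfold Q. apply brel_and; [easy|]. apply brel_and; [now apply brel_snd|].
      apply (sa_all (psigma B B)). intros i. apply (sa_imp (psigma B B)).
      - apply (brel_fst (fun x => exists y', H x y' /\ (U y' /\ c y' = i))).
        apply (brel_image N); auto. apply (sa_and B); [easy|apply Hc].
      - apply (brel_snd (fun y => c y <= i)).
        apply (natmeas_pred c (fun j _ => j <= i) Hc). intros j. borel. }
    assert (HQcov : covered N Q).
    { apply (covered_sub _ _ H); [|easy]. now intros x y [Hxy _]. }
    assert (HQuniq : forall x y y', Q x y -> Q x y' -> y = y').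
    { intros x y y' (Hy & HUy & Hmin) (Hy' & HUy' & Hmin'). apply NNPP. intros Hne.
      apply (Hprop y y'); [split; [exists x; auto|easy]|].
      apply Nat.le_antisymm; [apply Hmin|apply Hmin']; eauto. }
    assert (HQex : forall x, (exists y, H x y /\ U y) -> exists y, Q x y).
    { intros x (y & Hy & HUy).
      destruct (least_exists (fun i => exists y', H x y' /\ (U y' /\ c y' = i)))
        as (i & (z & Hz & HUz & <-) & Hmin).
      { exists (c y), y. auto. }
      exists z. repeat split; auto. intros i Hi. apply Nat.nlt_ge. intros Hlt.
      now apply (Hmin i). }
    destruct (choice (fun x y => Q x y \/ ((~ exists z, Q x z) /\ y = x))) as [p Hp].
    { intros x. destruct (classic (exists z, Q x z)) as [[z Hz]|Hno].
      - exists z. now left.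
      - exists x. now right. }
    assert (HpQ : forall x, (exists y, H x y /\ U y) -> Q x (p x)).
    { intros x Hx. apply HQex in Hx. now destruct (Hp x) as [HQx|[Hno _]]. }
    exists p, c, (N * N). repeat split; auto.
    (* Where [x] has no neighbor in [U], [p] is the identity. *)
    + intros S HS. apply (sa_ext (fun x => (exists y, Q x y /\ S y) \/
                                    ((~ exists y, Q x y /\ True) /\ S x))).
      * borel; apply (brel_image N); auto. borel.
      * intros x. destruct (Hp x) as [HQx|[Hno Heq]].
        -- split.
           ++ intros [(y & Hy & HSy)|[Hno _]].
              ** now rewrite (HQuniq x (p x) y HQx Hy).
              ** exfalso. apply Hno. now exists (p x).
           ++ intros HSx. left. now exists (p x).
        -- rewrite Heq. split.
           ++ intros [(y & Hy & _)|[_ HSx]]; [|easy]. exfalso. apply Hno. now exists y.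
           ++ intros HSx. right. split; [|easy]. intros (y & Hy & _). apply Hno. now exists y.
    + now apply HpQ.
    + now apply (HpQ x).
    + intros x x' Hx Hx' Heq Hceq. apply NNPP. intros Hne.
      apply (Hprop x x'); [|easy]. split; [|easy]. exists (p x). split.
      * now apply HpQ.
      * rewrite Heq. apply Hsym. now apply HpQ.
Qed.

End StandardBorel.

(** * Compressible graphs of bounded degree *)

(** Otherwise duplicate-free lists in [P] could be extended forever. This turns the degree bound
    into [covered]. *)
Lemma list_cover {V : Type} (D : nat) (P : V -> Prop) :
  (forall l, NoDup l -> (forall y, In y l -> P y) -> length l <= D) ->
  exists l, length l <= D /\ forall y, P y -> In y l.
Proof.
  intros HD. apply NNPP. intros Hno.
  assert (Hlong : forall n, exists l, NoDup l /\ (forall y, In y l -> P y) /\ length l = n).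
  { induction n as [|n (l & Hnd & HP & Hlen)].
    - exists nil. repeat split; [constructor|easy].
    - destruct (classic (exists y, P y /\ ~ In y l)) as [(y & Hy & Hyl)|Hall].
      + exists (y :: l). repeat split; [now constructor| |simpl; lia].
        intros z [<-|Hz]; auto.
      + exfalso. apply Hno. exists l. split; [now apply HD|].
        intros y Hy. apply NNPP. intros Hyl. apply Hall. now exists y. }
  destruct (Hlong (S D)) as (l & Hnd & HP & Hlen). specialize (HD l Hnd HP). lia.
Qed.

(** Infinite pigeonhole: if every value were eventually avoided, excluding them one at a time would
    push [c] above [M]. *)
Lemma bounded_infinitely_often (c : nat -> nat) (M : nat) : (forall n, c n <= M) ->
  exists j, forall N, exists n, N <= n /\ c n = j.
Proof.
  intros Hc. apply NNPP. intros Hno.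
  assert (Hlast : forall m, exists N, forall n, N <= n -> m <= c n).
  { induction m as [|m [N IH]]; [exists 0; lia|].
    assert (Hm : exists N', forall n, N' <= n -> c n <> m).
    { apply NNPP. intros Hinf. apply Hno. exists m. intros N'. apply NNPP. intros HN'.
      apply Hinf. exists N'. intros n Hn Heq. apply HN'. now exists n. }
    destruct Hm as [N' HN']. exists (max N N'). intros n Hn.
    specialize (IH n ltac:(lia)). specialize (HN' n ltac:(lia)). lia. }
  destruct (Hlast (S M)) as [N HN]. specialize (HN N (le_n N)). specialize (Hc N). lia.
Qed.

(* The junk value when [P] is empty is [0]. *)
Definition least (P : nat -> Prop) : nat :=
  match excluded_middle_informative (exists n, P n) with
  | left H => proj1_sig (constructive_indefinite_description _ (least_exists P H))
  | right _ => 0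
  end.

Lemma least_spec (P : nat -> Prop) : (exists n, P n) ->
  P (least P) /\ forall k, k < least P -> ~ P k.
Proof.
  intros H. unfold least. destruct (excluded_middle_informative _) as [H'|H']; [|easy].
  now destruct (constructive_indefinite_description _ _) as [n Hn].
Qed.

Lemma least_eq (P : nat -> Prop) i :
  least P = i <-> (P i /\ forall k, k < i -> ~ P k) \/ (i = 0 /\ forall n, ~ P n).
Proof.
  destruct (classic (exists n, P n)) as [HP|HP].
  - destruct (least_spec P HP) as [H1 H2]. split.
    + intros <-. now left.
    + intros [[Hi Hk]|[_ Hn]].
      * destruct (lt_eq_lt_dec (least P) i) as [[Hlt|Heq]|Hlt]; [|easy|].
        -- exfalso. now apply (Hk (least P)).
        -- exfalso. now apply (H2 i).
      * destruct HP as [n HPn]. exfalso. now apply (Hn n).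
  - unfold least. destruct (excluded_middle_informative _) as [H'|H']; [easy|]. split.
    + intros <-. right. split; [easy|]. intros n Hn. apply HP. now exists n.
    + intros [[Hi _]|[-> _]]; [|easy]. exfalso. apply HP. now exists i.
Qed.

Lemma natmeas_least {X : Type} (B : (X -> Prop) -> Prop) `{SigmaAlgebra X B}
    (P : nat -> X -> Prop) :
  (forall n, B (P n)) -> natmeas B (fun x => least (fun n => P n x)).
Proof.
  intros HP i.
  apply (sa_ext (fun x => (P i x /\ forall k, k < i -> ~ P k x) \/ (i = 0 /\ forall n, ~ P n x))).
  - borel; apply HP.
  - intros x. symmetry. apply least_eq.
Qed.

(** Increasing enumeration of [P], meaningful when [P] is infinite; otherwise the default value of
    [least] can appear. *)
Fixpoint nth_true (P : nat -> Prop) (m : nat) : nat :=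
  match m with
  | 0 => least P
  | S m => least (fun n => nth_true P m < n /\ P n)
  end.

Lemma nth_true_spec (P : nat -> Prop) : (forall N, exists n, N <= n /\ P n) ->
  (forall m, P (nth_true P m)) /\ (forall m m', nth_true P m = nth_true P m' -> m = m').
Proof.
  intros Hinf.
  assert (Hstep : forall m, nth_true P m < nth_true P (S m) /\ P (nth_true P (S m))).
  { intros m. simpl. apply (least_spec (fun n => nth_true P m < n /\ P n)).
    destruct (Hinf (S (nth_true P m))) as (n & Hn & HPn). now exists n. }
  assert (Hlt : forall m m', m < m' -> nth_true P m < nth_true P m').
  { intros m m' Hm. induction Hm as [|m' Hm IH]; [apply Hstep|].
    pose proof (proj1 (Hstep m')). lia. }
  split.
  - intros [|m]; [|apply Hstep]. apply (least_spec P). destruct (Hinf 0) as (n & _ & Hn).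
    now exists n.
  - intros m m' Heq. destruct (lt_eq_lt_dec m m') as [[H|H]|H]; [|easy|];
      apply Hlt in H; lia.
Qed.

Section BoundedDegreeGraph.
Context {V : Type} (B : (V -> Prop) -> Prop) (HV : standard_borel B)
  (E : V -> V -> Prop) (Esym : forall x y, E x y -> E y x)
  (EB : brel B E) (D : nat) (ED : covered D E).

#[local] Instance graph_borel_algebra : SigmaAlgebra B := standard_borel_algebra B HV.

Lemma natmeas_nth_true (P : nat -> V -> Prop) m :
  (forall n, B (P n)) -> natmeas B (fun x => nth_true (fun n => P n x) m).
Proof.
  intros HP. induction m as [|m IH]; simpl; [now apply (natmeas_least B)|].
  apply (natmeas_least B (fun n x => nth_true (fun n => P n x) m < n /\ P n x)).
  intros n. apply (sa_and B); [|apply HP].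
  apply (natmeas_pred B HV _ (fun i _ => i < n) IH). intros i. borel.
Qed.

(** * Graph balls, components and Borel saturations *)

Fixpoint ball (n : nat) : V -> V -> Prop :=
  match n with
  | 0 => eq
  | S n => fun x z => exists y, ball n x y /\ (y = z \/ E y z)
  end.

Fixpoint ball_size (n : nat) : nat :=
  match n with 0 => 1 | S n => ball_size n * S D end.

Lemma covered_refl_edge : covered (S D) (fun y z => y = z \/ E y z).
Proof.
  intros y. destruct (ED y) as (l & Hl & Hin). exists (y :: l). split; [simpl; lia|].
  intros z [->|Hz]; [now left|right; auto].
Qed.

Lemma ball_covered n : covered (ball_size n) (ball n).
Proof.
  induction n as [|n IH].
  - intros x. exists (x :: nil). split; [easy|]. intros y Hy. now left.
  - apply covered_comp; [easy|]. apply covered_refl_edge.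
Qed.

Lemma ball_borel n : brel B (ball n).
Proof.
  induction n as [|n IH]; [now apply brel_eq|].
  apply (brel_comp B HV (ball_size n)); [easy|apply ball_covered|].
  apply brel_or; [now apply brel_eq|easy].
Qed.

Lemma ball_le n m x y : n <= m -> ball n x y -> ball m x y.
Proof.
  intros Hnm Hxy. induction Hnm as [|m Hnm IH]; [easy|]. exists y. auto.
Qed.

Lemma ball_refl n x : ball n x x.
Proof. apply (ball_le 0); [lia|easy]. Qed.

Lemma ball_trans n m x y z : ball n x y -> ball m y z -> ball (n + m) x z.
Proof.
  intros Hxy. revert z. induction m as [|m IH]; intros z Hz.
  - simpl in Hz. subst z. now rewrite Nat.add_0_r.
  - destruct Hz as (w & Hw & Hwz). rewrite Nat.add_succ_r. exists w. auto.
Qed.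

Lemma ball_edge x y : E x y -> ball 1 x y.
Proof. intros H. exists x. simpl. auto. Qed.

Lemma ball_sym n x y : ball n x y -> ball n y x.
Proof.
  revert y. induction n as [|n IH]; intros y.
  - simpl. congruence.
  - intros (z & Hz & Hzy). apply (ball_trans 1 n y z); [|now apply IH].
    destruct Hzy as [->|Hzy]; [apply ball_refl|]. now apply ball_edge, Esym.
Qed.

Lemma conn_ball x y : conn E x y <-> exists n, ball n x y.
Proof.
  split.
  - intros Hxy. induction Hxy as [x y Hxy|x|x y z _ [n IH1] _ [m IH2]].
    + exists 1. now apply ball_edge.
    + now exists 0.
    + exists (n + m). now apply (ball_trans n m x y).
  - intros [n Hn]. revert y Hn. induction n as [|n IH]; intros y Hn.
    + simpl in Hn. subst y. apply rt_refl.
    + destruct Hn as (z & Hz & [->|Hzy]); [now apply IH|].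
      apply rt_trans with z; [now apply IH|now apply rt_step].
Qed.

Lemma conn_sym x y : conn E x y -> conn E y x.
Proof. rewrite !conn_ball. intros [n Hn]. exists n. now apply ball_sym. Qed.

Lemma conn_trans x y z : conn E x y -> conn E y z -> conn E x z.
Proof. apply rt_trans. Qed.

Lemma ball_image_borel n U : B U -> B (fun x => exists y, ball n x y /\ U y).
Proof. apply (brel_image B HV (ball_size n)); [apply ball_borel|apply ball_covered]. Qed.

Lemma saturation_borel U : B U -> B (saturation E U).
Proof.
  intros HU. apply (sa_ext (fun x => exists n y, ball n x y /\ U y)).
  - apply sa_ex. intros n. now apply ball_image_borel.
  - intros x. split.
    + intros (n & y & Hy & HUy). exists y. split; [easy|]. apply conn_ball. now exists n.
    + intros (y & HUy & Hy). apply conn_ball in Hy as [n Hn]. now exists n, y.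
Qed.

(** An embedding of [V] into [C * nat]: each point retracts to [C] at the least radius at which its
    ball meets [C], and [m] pairs this radius with the label separating points of equal
    retraction. *)
Lemma complete_section_coordinates (C : V -> Prop) :
  B C -> (forall x, saturation E C x) ->
  exists (a : V -> V) (m : V -> nat), meas B B a /\ natmeas B m /\
    (forall x, C (a x)) /\ (forall x, conn E x (a x)) /\
    (forall x y, a x = a y -> m x = m y -> x = y).
Proof.
  intros HC Hsat.
  destruct (choice (fun r (q : (V -> V) * (V -> nat)) =>
      meas B B (fst q) /\ natmeas B (snd q) /\
      (forall x, (exists y, ball r x y /\ C y) -> ball r x (fst q x) /\ C (fst q x)) /\
      (forall x x', (exists y, ball r x y /\ C y) -> (exists y, ball r x' y /\ C y) ->
         fst q x = fst q x' -> snd q x = snd q x' -> x = x'))) as [q Hq].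
  { intros r. destruct (finite_to_one_retraction B HV (ball_size r) (ball r) C)
      as (p & c & M & Hp & Hc & _ & H1 & H2); auto using ball_borel, ball_covered, ball_sym.
    now exists (p, c). }
  set (P := fun r x => exists y, ball r x y /\ C y).
  set (rho := fun x => least (fun r => P r x)).
  assert (Hrho : natmeas B rho).
  { apply natmeas_least; [exact _|]. intros r. now apply ball_image_borel. }
  assert (HP : forall x, P (rho x) x).
  { intros x. apply (least_spec (fun r => P r x)). destruct (Hsat x) as (y & HCy & Hy).
    apply conn_ball in Hy as [r Hr]. now exists r, y. }
  exists (fun x => fst (q (rho x)) x), (fun x => to_nat (rho x, snd (q (rho x)) x)).
  repeat split.
  - apply (natmeas_glue B HV rho (fun r => fst (q r)) Hrho). intros r. apply Hq.
  - intros i. apply (natmeas_pred B HV rho (fun r x => to_nat (r, snd (q r) x) = i) Hrho).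
    intros r. apply (natmeas_pred B HV (snd (q r)) (fun j _ => to_nat (r, j) = i)).
    + apply Hq.
    + intros j. borel.
  - intros x. apply (Hq (rho x)). apply HP.
  - intros x. apply conn_ball. exists (rho x). apply (Hq (rho x)). apply HP.
  - intros x y Ha Hm. apply to_nat_inj in Hm. injection Hm as Hr Hc.
    pose proof (HP x) as Hx. pose proof (HP y) as Hy. rewrite <- Hr in Ha, Hc, Hy.
    now apply (Hq (rho x)).
Qed.

Definition dense (R : nat) (U : V -> Prop) : Prop := forall x, exists y, ball R x y /\ U y.

(** * Orbits of a compression and dense color classes *)

Section Compressible.
Context (phi : V -> V) (A : V -> Prop) (phi_meas : meas B B phi)
  (phi_inj : forall x y, phi x = phi y -> x = y) (phi_conn : forall x, conn E x (phi x))
  (A_borel : B A) (A_complete : forall x, saturation E A x) (A_phi : forall x, ~ A (phi x)).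

Definition orbit (n : nat) (x : V) : V := Nat.iter n phi x.

Lemma orbit_meas n : meas B B (orbit n).
Proof.
  induction n as [|n IH]; [apply meas_id|].
  exact (meas_comp B B B phi (orbit n) phi_meas IH).
Qed.

Lemma orbit_conn n x : conn E x (orbit n x).
Proof.
  induction n as [|n IH]; [apply rt_refl|]. apply (conn_trans _ _ _ IH), phi_conn.
Qed.

(** A point of [A] is not a value of [phi], so cancelling [phi] exhausts both sides
    simultaneously. *)
Lemma orbit_inj n m x y : A x -> A y -> orbit n x = orbit m y -> n = m /\ x = y.
Proof.
  intros Hx Hy. revert m. induction n as [|n IH]; intros [|m] Heq.
  - easy.
  - exfalso. apply (A_phi (orbit m y)). change (x = phi (orbit m y)) in Heq. now rewrite <- Heq.
  - exfalso. apply (A_phi (orbit n x)). change (phi (orbit n x) = y) in Heq. now rewrite Heq.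
  - apply phi_inj in Heq. destruct (IH m Heq). auto.
Qed.

(** A ball that stops growing is the whole component. But balls are finite, and the component
    contains the infinite orbit of a point of [A]. *)
Lemma sphere_nonempty n x : exists w, ball (S n) x w /\ ~ ball n x w.
Proof.
  apply NNPP. intros Hno.
  assert (Hclosed : forall y z, ball n x y -> E y z -> ball n x z).
  { intros y z Hy Hz. apply NNPP. intros Hn. apply Hno. exists z. split; [|easy].
    exists y. auto. }
  assert (Hall : forall y, conn E x y -> ball n x y).
  { intros y Hy. apply clos_rt_rtn1 in Hy. induction Hy as [|y z Hyz _ IH].
    - apply ball_refl.
    - now apply (Hclosed y z). }
  destruct (ball_covered n x) as (l & _ & Hin).
  destruct (A_complete x) as (a & Ha & Hxa).
  assert (Hinc : incl (map (fun i => orbit i a) (seq 0 (S (length l)))) l).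
  { intros y Hy. apply in_map_iff in Hy as (i & <- & _). apply Hin, Hall.
    apply (conn_trans _ _ _ Hxa), orbit_conn. }
  apply NoDup_incl_length in Hinc.
  - rewrite length_map, length_seq in Hinc. lia.
  - apply Injective_map_NoDup; [|apply seq_NoDup].
    intros i j Hij. now apply (orbit_inj i j a a).
Qed.

(* On each component choose a label [j] that some orbit starting in [A] visits infinitely
   often. The starting points [C] of such orbits form a complete section, and the retractions
   of the visits with label [j] inject [C * nat], hence [V], into [U]. *)
Lemma inject_into_dense R U : B U -> dense R U ->
  exists Phi : V -> V, meas B B Phi /\ (forall x, U (Phi x)) /\
    (forall x, conn E x (Phi x)) /\ (forall x y, Phi x = Phi y -> x = y).
Proof.
  intros HU Hdense.
  destruct (finite_to_one_retraction B HV (ball_size R) (ball R) U)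
    as (p & c & M & Hp & Hc & HcM & Hp1 & Hp2); auto using ball_borel, ball_covered, ball_sym.
  set (lab := fun j n x => c (orbit n x) = j).
  assert (Hlab : forall j n, B (lab j n)).
  { intros j n. apply (orbit_meas n (fun x => c x = j)). apply Hc. }
  set (inf := fun j x => A x /\ forall N, exists n, N <= n /\ lab j n x).
  assert (Hinf : forall j, B (inf j)).
  { intros j. unfold inf. borel. apply Hlab. }
  (* Passing through saturations makes the chosen label constant on components. *)
  set (J := fun x => least (fun j => saturation E (inf j) x)).
  assert (HJ : natmeas B J).
  { apply natmeas_least; [exact _|]. intros j. now apply saturation_borel. }
  assert (HJsat : forall x, saturation E (inf (J x)) x).
  { intros x. apply (least_spec (fun j => saturation E (inf j) x)).
    destruct (A_complete x) as (a & Ha & Hxa).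
    destruct (bounded_infinitely_often (fun n => c (orbit n a)) M) as [j Hj]; [easy|].
    now exists j, a. }
  assert (HJconn : forall x y, conn E x y -> J x = J y).
  { intros x y Hxy. unfold J. f_equal. apply functional_extensionality. intros j.
    apply propositional_extensionality.
    split; intros (a & Ha & Hc'); exists a; (split; [easy|]).
    - apply conn_trans with x; [now apply conn_sym|easy].
    - now apply conn_trans with y. }
  set (C := fun x => inf (J x) x).
  destruct (complete_section_coordinates C) as (a & m & Ha & Hm & HCa & Hconn & Hinj).
  { now apply (natmeas_pred B HV J inf). }
  { intros x. destruct (HJsat x) as (y & Hy & Hxy). exists y. split; [|easy].
    unfold C. now rewrite <- (HJconn x y). }
  (* The coordinate [m x] chooses which visit of the orbit of [a x] to the chosen label represents
     [x]. *)
  set (nu := fun x => nth_true (fun n => lab (J (a x)) n (a x)) (m x)).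
  assert (Hnu : natmeas B nu).
  { intros i.
    apply (natmeas_pred B HV m (fun m x => nth_true (fun n => lab (J (a x)) n (a x)) m = i) Hm).
    intros k. apply (Ha (fun y => nth_true (fun n => lab (J y) n y) k = i)).
    apply (natmeas_nth_true (fun n y => lab (J y) n y)). intros n.
    now apply (natmeas_pred B HV J (fun j => lab j n)). }
  assert (Hnth : forall x, lab (J (a x)) (nu x) (a x) /\
            forall k, nu x = nth_true (fun n => lab (J (a x)) n (a x)) k -> m x = k).
  { intros x. destruct (HCa x) as [_ Hx]. apply nth_true_spec in Hx as [H1 H2].
    split; [apply H1|]. intros k. apply H2. }
  exists (fun x => p (orbit (nu x) (a x))). repeat split.
  - apply (meas_comp B B B p); [easy|].
    apply (natmeas_glue B HV nu (fun n x => orbit n (a x)) Hnu). intros n.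
    apply (meas_comp B B B (orbit n)); [apply orbit_meas|easy].
  - intros x. apply Hp1, Hdense.
  - intros x. apply (conn_trans _ _ _ (Hconn x)).
    apply (conn_trans _ _ _ (orbit_conn (nu x) (a x))).
    apply conn_ball. exists R. apply Hp1, Hdense.
  - intros x y Heq.
    assert (Hconnp : forall x, conn E (a x) (p (orbit (nu x) (a x)))).
    { intros z. apply (conn_trans _ _ _ (orbit_conn (nu z) (a z))).
      apply conn_ball. exists R. apply Hp1, Hdense. }
    assert (HJxy : J (a x) = J (a y)).
    { apply HJconn. apply (conn_trans _ _ _ (Hconnp x)). rewrite Heq.
      apply conn_sym, Hconnp. }
    destruct (Hnth x) as [Hx Hmx]. destruct (Hnth y) as [Hy Hmy].
    (* Equal labels and equal retractions give the same visited point; disjointness of orbits then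
       returns the starting point and the time, which determine [x]. *)
    assert (Ho : orbit (nu x) (a x) = orbit (nu y) (a y)).
    { apply Hp2; auto. unfold lab in Hx, Hy. congruence. }
    apply orbit_inj in Ho as [Hn Hae]; [|apply HCa|apply HCa].
    apply Hinj; [easy|]. apply Hmx. rewrite Hn, Hae. reflexivity.
Qed.

(** Each step makes one more class dense. Recoloring is confined to an [r]-separated set, so no two
    recolored vertices are adjacent, and of two distinct vertices within distance [r] at most one is
    recolored. *)
Lemma dense_color_classes k (f : V -> nat) : (forall x, ~ E x x) ->
  borel_proper_coloring B E k f -> forall i, i <= k ->
  exists R g, borel_proper_coloring B E k g /\ forall j, j < i -> dense R (fun x => g x = j).
Proof.
  intros Eirr Hf i. induction i as [|i IH]; intros Hi.
  { exists 0, f. split; [easy|]. intros j Hj. lia. }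
  destruct IH as (R & g & (Hgk & HgB & Hgp) & Hgd); [lia|].
  (* A second vertex of an old color is found within [(R + 1) + R] of the first. *)
  set (r := 2 * R + 1).
  destruct (maximal_independent B HV (ball_size r) (fun x y => ball r x y /\ x <> y))
    as (S & HS & Hind & Hmax).
  { apply brel_and; [apply ball_borel|now apply brel_neq]. }
  { apply (covered_sub _ _ (ball r)); [tauto|apply ball_covered]. }
  { intros x y [Hxy Hne]. split; [now apply ball_sym|congruence]. }
  { tauto. }
  (* Vertices of [S] next to color [i] are left alone: this keeps the coloring proper, and color [i]
     is already adjacent to them. *)
  set (T := fun x => S x /\ ~ exists y, E x y /\ g y = i).
  assert (HT : B T).
  { apply (sa_and B); [easy|]. apply sa_not. apply (brel_image B HV D); auto. }
  set (h := fun x => if excluded_middle_informative (T x) then i else g x).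
  assert (hT : forall x, T x -> h x = i).
  { intros x Hx. unfold h. now destruct (excluded_middle_informative (T x)). }
  assert (hN : forall x, ~ T x -> h x = g x).
  { intros x Hx. unfold h. now destruct (excluded_middle_informative (T x)). }
  assert (hi : forall x, g x = i -> h x = i).
  { intros x Hx. destruct (classic (T x)); [now apply hT|]. now rewrite hN. }
  (* Large enough for color [i], reached within [r + 1 = 2 * R + 2], and for the older colors,
     reached within [R + r = 3 * R + 1]. *)
  exists (3 * R + 2), h. split; [split; [|split]|].
  - intros x. destruct (classic (T x)); [rewrite hT|rewrite hN]; auto.
  - intros j. apply (sa_ext (fun x => (T x /\ i = j) \/ (~ T x /\ g x = j))).
    + borel. apply HgB.
    + intros x. destruct (classic (T x)) as [Hx|Hx].
      * rewrite (hT x Hx). tauto.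
      * rewrite (hN x Hx). tauto.
  - intros x y Hxy. destruct (classic (T x)) as [Hx|Hx]; destruct (classic (T y)) as [Hy|Hy].
    + exfalso. apply (Hind x y); [apply Hx|apply Hy|]. split.
      * apply (ball_le 1); [lia|]. now apply ball_edge.
      * intros ->. now apply (Eirr y).
    + rewrite (hT x Hx), (hN y Hy). intros Heq. apply (proj2 Hx). now exists y.
    + rewrite (hN x Hx), (hT y Hy). intros Heq. apply (proj2 Hy). exists x. auto.
    + rewrite (hN x Hx), (hN y Hy). now apply Hgp.
  - intros j Hj x.
    destruct (Nat.eq_dec j i) as [->|Hji].
    + assert (Hs : exists s, ball r x s /\ S s).
      { destruct (Hmax x) as [Hx|(y & [Hy _] & HSy)]; [exists x|now exists y].
        split; [apply ball_refl|easy]. }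
      destruct Hs as (s & Hxs & HSs).
      destruct (classic (exists y, E s y /\ g y = i)) as [(y & Hy & Hgy)|Hno].
      * exists y. split; [|now apply hi]. apply (ball_le (r + 1)); [lia|].
        apply (ball_trans r 1 x s); [easy|now apply ball_edge].
      * exists s. split; [apply (ball_le r); [lia|easy]|]. apply hT. now split.
    + assert (Hold : forall x, exists y, ball R x y /\ g y = j) by (apply Hgd; lia).
      destruct (Hold x) as (y & Hxy & Hgy).
      destruct (classic (T y)) as [HTy|HTy].
      2: { exists y. split; [apply (ball_le R); [lia|easy]|]. now rewrite hN. }
      (* another vertex [z] of color [j] is too close to [y] to be recolored as well *)
      destruct (sphere_nonempty R y) as (w & Hyw & Hyw').
      destruct (Hold w) as (z & Hwz & Hgz).
      assert (Hyz : ball r y z).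
      { unfold r. replace (2 * R + 1) with (Datatypes.S R + R) by lia. now apply (ball_trans _ _ y w). }
      assert (Hne : y <> z) by (intros <-; apply Hyw'; now apply ball_sym).
      exists z. split.
      * apply (ball_le (R + r)); [lia|]. now apply (ball_trans _ _ x y).
      * rewrite hN; [easy|]. intros [HSz _]. apply (Hind y z); [apply HTy|easy|]. now split.
Qed.

End Compressible.

(** * Borel equidecompositions by the Schroeder-Bernstein argument *)

Lemma injective_image_borel (f : V -> V) (S : V -> Prop) :
  meas B B f -> (forall x y, f x = f y -> x = y) -> B S -> B (fun y => exists x, f x = y /\ S x).
Proof.
  intros Hf Hinj HS.
  destruct (standard_borel_structure B HV) as (_ & (O & HO) & Hproj & _).
  (* The image is a projection of the transposed graph of [f], whose sections have at most one point
     by injectivity. *)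
  apply (Hproj V B O (fun p => f (snd p) = fst p /\ S (snd p))); [exact _|easy| |].
  - apply (sa_and (psigma B B)).
    + apply (borel_eq B HV (psigma B B)); [|apply meas_fst; exact _].
      apply (meas_comp _ B B f snd Hf). apply meas_snd. exact _.
    + now apply (meas_snd B B).
  - simpl. intros y x x' [Hx _] [Hx' _]. apply Hinj. congruence.
Qed.

(** [K] is generated from the points of [P] outside the [h]-image of [Q] by applying [g] and then
    [h]. The bijection is [g] on [K] and the inverse of [h] on the rest of [P]. *)
Lemma schroeder_bernstein (P Q : V -> Prop) (g h : V -> V) :
  B P -> B Q -> meas B B g -> meas B B h ->
  (forall x, Q (g x)) -> (forall x, P (h x)) ->
  (forall x, conn E x (g x)) -> (forall x, conn E x (h x)) ->
  (forall x y, g x = g y -> x = y) -> (forall x y, h x = h y -> x = y) ->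
  borel_equidec B E P Q.
Proof.
  intros HP HQ Hg Hh gQ hP gc hc ginj hinj.
  set (im := fun (f : V -> V) (S : V -> Prop) y => exists x, f x = y /\ S x).
  assert (Him : forall f S, meas B B f -> (forall x y, f x = f y -> x = y) -> B S -> B (im f S)).
  { exact injective_image_borel. }
  set (C := fix C n := match n with
    | 0 => fun x => P x /\ ~ im h Q x
    | S n => im h (im g (C n))
    end).
  assert (HC : forall n, B (C n)).
  { induction n as [|n IH]; simpl.
    - apply (sa_and B); [easy|]. apply sa_not. now apply Him.
    - apply Him; auto. }
  set (K := fun x => exists n, C n x).
  assert (HK : B K) by now apply sa_ex.
  (* Outside both [K] and [P] the value is arbitrary, since an equidecomposition constrains only
     [P]. *)
  destruct (choice (fun x y => (K x /\ y = g x) \/ (~ K x /\ (P x -> Q y /\ h y = x))))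
    as [f Hf].
  { intros x. destruct (classic (K x)) as [Hx|Hx]; [exists (g x); now left|].
    destruct (classic (P x)) as [HPx|HPx]; [|exists x; now right].
    destruct (classic (im h Q x)) as [(y & Hy & HQy)|Hno].
    - exists y. right. auto.
    - exfalso. apply Hx. exists 0. now split. }
  exists f. split; [|split; [|split; [|split]]].
  - intros S HS.
    apply (sa_ext (fun x => (P x /\ K x /\ S (g x)) \/
             (P x /\ ~ K x /\ im h (fun y => Q y /\ S y) x))).
    + assert (B (fun x => S (g x))) by now apply Hg.
      assert (B (im h (fun y => Q y /\ S y))) by (apply Him; auto; borel).
      borel.
    + intros x. destruct (Hf x) as [[HKx ->]|[HKx Hfx]]; [tauto|]. split.
      * intros [(_ & Hk & _)|(HPx & _ & y & Hy & HQy & HSy)]; [easy|]. split; [easy|].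
        replace (f x) with y; [easy|]. apply hinj. rewrite Hy. symmetry. now apply Hfx.
      * intros [HPx HSx]. right. destruct (Hfx HPx) as [HQf Hhf].
        repeat split; auto. now exists (f x).
  - intros x HPx. destruct (Hf x) as [[HKx ->]|[HKx Hfx]]; [apply gQ|now apply Hfx].
  (* [K] is closed under [g] followed by [h], so a value of [g] on [K] is never the [h]-preimage of
     a point outside [K]. *)
  - assert (Hmix : forall x y, P y -> K x -> ~ K y -> g x = f y -> False).
    { intros x y HPy [n Hn] HKy Heq. apply HKy. exists (S n). exists (g x). split; [|now exists x].
      destruct (Hf y) as [[HKy' _]|[_ Hfy]]; [easy|]. rewrite Heq. now apply Hfy. }
    intros x y HPx HPy Heq.
    destruct (Hf x) as [[HKx Hx]|[HKx Hfx]]; destruct (Hf y) as [[HKy Hy]|[HKy Hfy]].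
    + apply ginj. congruence.
    + exfalso. apply (Hmix x y); auto. congruence.
    + exfalso. apply (Hmix y x); auto. congruence.
    + rewrite <- (proj2 (Hfx HPx)), <- (proj2 (Hfy HPy)). now rewrite Heq.
  - intros y HQy. destruct (classic (K (h y))) as [[[|n] Hn]|HK'].
    + exfalso. apply (proj2 Hn). now exists y.
    + destruct Hn as (z & Hz & x & Hx & Hnx). apply hinj in Hz. subst z.
      exists x. split.
      * destruct n as [|n]; [apply Hnx|]. destruct Hnx as (z & <- & _). apply hP.
      * destruct (Hf x) as [[_ ->]|[Hno _]]; [easy|]. exfalso. apply Hno. now exists n.
    + exists (h y). split; [apply hP|].
      destruct (Hf (h y)) as [[Hyes _]|[_ Hfx]]; [easy|]. apply hinj. now apply Hfx.
  - intros x HPx. destruct (Hf x) as [[HKx ->]|[HKx Hfx]]; [apply gc|].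
    destruct (Hfx HPx) as [_ Hhf]. apply conn_sym. rewrite <- Hhf at 2. apply hc.
Qed.

End BoundedDegreeGraph.

Theorem theorem3p14 (V : Type) (B : (V -> Prop) -> Prop) (E : V -> V -> Prop) (k : nat) :
  borel_graph B E ->
  finite_max_degree E ->
  compressible B E ->
  (exists f : V -> nat, borel_proper_coloring B E k f) ->
  exists g : V -> nat, borel_equitable_coloring B E k g.
Proof.
  intros (HV & Esym & Eirr & EB) [D HD] (A & HA & _ & Hsat & phi & Hphi) [f Hf].
  destruct Hphi as (Hm & HphiA & Hinj & _ & Hconn).
  assert (ED : covered D E).
  { intros x. apply list_cover. intros l Hnd Hl. now apply (HD x). }
  pose proof (standard_borel_algebra B HV) as HB.
  assert (phi_meas : meas B B phi).
  { intros S HS. apply (sa_ext _ _ (Hm S HS)). tauto. }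
  assert (A_complete : forall x, saturation E A x).
  { intros x. apply Hsat. exists x. split; [easy|]. apply rt_refl. }
  assert (phi_inj : forall x y, phi x = phi y -> x = y) by auto.
  assert (phi_conn : forall x, conn E x (phi x)) by auto.
  assert (A_phi : forall x, ~ A (phi x)) by (intros x; now apply HphiA).
  (* With [i = k], all color classes are dense for one common radius [R]. *)
  destruct (dense_color_classes B HV E Esym EB D ED phi A phi_inj phi_conn A_complete A_phi
              k f Eirr Hf k (le_n k)) as (R & g & Hg & Hdense).
  assert (Hinto : forall a, a < k -> exists Phi : V -> V, meas B B Phi /\
            (forall x, g (Phi x) = a) /\ (forall x, conn E x (Phi x)) /\
            (forall x y, Phi x = Phi y -> x = y)).
  { intros a Ha. apply (inject_into_dense B HV E Esym EB D ED phi A phi_meas phi_inj phi_conn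
                          HA A_complete A_phi R (fun x => g x = a)).
    - apply Hg.
    - now apply Hdense. }
  exists g. split; [easy|]. intros a b Ha Hb.
  destruct (Hinto b Hb) as (p & Hp1 & Hp2 & Hp3 & Hp4).
  destruct (Hinto a Ha) as (q & Hq1 & Hq2 & Hq3 & Hq4).
  apply (schroeder_bernstein B HV E Esym _ _ p q); auto; apply Hg.
Qed.
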